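(* Let $\Omega_{dif}$ be the set of potentials $q\in L_1(0,\pi)$ of diffusion equations, with the norm $\|\cdot\|_1$ of $L_1(0,\pi)$, and let $\Sigma_{dif1}$ be the set of double sequences that are quasinodal to some $q\in\Omega_{dif}$, with the pseudometric $d_{\Sigma_{dif}}$ (all defined in the context). Let $\sim$ be the equivalence relation on $\Sigma_{dif1}$ given by $X\sim\overline X$ if and only if $d_{\Sigma_{dif}}(X,\overline X)=0$. Then the metric spaces $(\Omega_{dif},\|\cdot\|_1)$ and $(\Sigma_{dif1}/\sim,\,d_{\Sigma_{dif}})$ are homeomorphic to each other. Furthermore, if $X,\overline X\in\Sigma_{dif1}$ are quasinodal to $q,\overline q\in\Omega_{dif}$ respectively and $d_{\Sigma_{dif}}(X,\overline X)<1$, then $$\|q-\overline q\|_1=\frac{2\,d_{\Sigma_{dif}}(X,\overline X)}{1-d_{\Sigma_{dif}}(X,\overline X)}.$$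
   Context: The diffusion equation is $y''+[\lambda^2-2\lambda p(x)-q(x)]y=0$ on $(0,\pi)$ with spectral parameter $\lambda$, $p\in W_2^2[0,\pi]$ (Sobolev space) and $q\in L_1(0,\pi)$. $\Omega_{dif}$ is the set of $q\in L_1(0,\pi)$ that are potential functions of such an equation. Let $\mathbb{N}'=\mathbb{N}\setminus\{1,2\}$. $\Sigma_{dif}$ is the collection of all double sequences $X=\{X_k^n: k=1,\dots,n,\ n\in\mathbb{N}'\}$ with $0<X_1^n<X_2^n<\dots<X_n^n\le\pi$ for each $n$. Put $L_k^n=X_{k+1}^n-X_k^n$ for $k=1,\dots,n-1$ (grid lengths). $X\in\Sigma_{dif}$ is quasinodal to $q\in\Omega_{dif}$, where $q$ is the potential of the diffusion equation with coefficients $p,q$, if the functions $F_n$ defined by $F_n(x)=n\left[2n^2L_k^n-2n\pi-2p(x)\right]$ for $x\in[X_k^n,X_{k+1}^n)$, $k=1,\dots,n-1$, and $F_n(x)=0$ otherwise, converge to $q$ in $L_1(0,\pi)$ as $n\to\infty$, and in addition one of the following holds uniformly in $k=1,\dots,n$ as $n\to\infty$: Case (I) (boundary conditions $y'(0)-hy(0)=0$, $y'(\pi)+Hy(\pi)=0$ with $h,H\in\mathbb{R}$): $X_k^n=\frac{(k-\frac12)\pi}{n}+O\left(\frac1{n^2}\right)$; Case (II) (initial conditions $y(0)=0$, $y'(0)=1$ and boundary condition $y'(\pi)+Hy(\pi)=0$): $X_k^n=\frac{k\pi}{n}+O\left(\frac1{n^2}\right)$. The function $p$ appearing here is called the function $p$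 associated with $X$. For $X,\overline X\in\Sigma_{dif1}$ with grid lengths $L_k^n,\overline L_k^n$ and associated functions $p,\overline p$, let $$S_n(X,\overline X)=n^2\pi\sum_{k=1}^{n-1}\left|L_k^n-\overline L_k^n\right|+n\int_0^\pi|p(x)-\overline p(x)|\,dx,$$ $$d_{\Sigma_{dif}}(X,\overline X)=\limsup_{n\to\infty}\frac{S_n(X,\overline X)}{1+S_n(X,\overline X)}.$$ When $X$ and $\overline X$ belong to different cases, $d_{\Sigma_{dif}}(X,\overline X)=1$.
   Formalization: The homeomorphism is stated for each of Cases (I) and (II) separately, between Ω_dif and the classes of that case: with both cases together Σ_dif1/∼ is disconnected (distance 1 across cases), while Ω_dif = L_1(0,π) is connected. *)

(* Defs.v *)
From HB Require Import structures.
From mathcomp Require Import all_boot all_order all_algebra.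
From mathcomp Require Import generic_quotient.
From mathcomp Require Import all_classical all_reals all_analysis.
From mathcomp Require Import ring lra.

Set Implicit Arguments.
Unset Strict Implicit.
Unset Printing Implicit Defensive.

Import Order.TTheory GRing.Theory Num.Theory.
Import numFieldNormedType.Exports.

Local Open Scope classical_set_scope.
Local Open Scope ring_scope.

Definition homeomorphic (T U : topologicalType) : Prop :=
  exists (f : T -> U) (g : U -> T),
    [/\ cancel f g, cancel g f, continuous f & continuous g].

(* A pseudometric [d] on [T], and the metric space obtained by identifying the
   points at distance 0. *)
Record pseudodist (R : realType) (T : Type) := PseudoDist {
  pdist : T -> T -> R ;
  pdistxx : forall x, pdist x x = 0 ;
  pdist_ge0 : forall x y, 0 <= pdist x y ;
  pdist_sym : forall x y, pdist x y = pdist y x ;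
  pdist_triangle : forall y x z, pdist x z <= pdist x y + pdist y z }.

Section MetricQuotient.
Variables (R : realType) (T : choiceType) (D : pseudodist R T).
Local Open Scope quotient_scope.

Definition dist0 (x y : T) : bool := pdist D x y == 0.

Lemma dist0_refl : reflexive dist0.
Proof. by move=> x; rewrite /dist0 pdistxx. Qed.

Lemma dist0_sym : symmetric dist0.
Proof. by move=> x y; rewrite /dist0 pdist_sym. Qed.

Lemma dist0_trans : transitive dist0.
Proof.
move=> y x z /eqP xy /eqP yz; rewrite /dist0 eq_le pdist_ge0 andbT.
by rewrite (le_trans (pdist_triangle D y x z))// xy yz addr0.
Qed.

Canonical dist0_equiv := EquivRel dist0 dist0_refl dist0_sym dist0_trans.

Definition metric_quotient : Type := {eq_quot dist0}.
HB.instance Definition _ := Choice.on metric_quotient.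
HB.instance Definition _ := EqQuotient.on metric_quotient.

Definition qdist (x y : metric_quotient) : R := pdist D (repr x) (repr y).

Lemma qdist_piE (x y : T) :
  qdist (\pi_metric_quotient x) (\pi_metric_quotient y) = pdist D x y.
Proof.
have rE z : pdist D (repr (\pi_metric_quotient z)) z = 0.
  by apply/eqP; rewrite -/(dist0 _ _) -[dist0 _ _]/(dist0_equiv _ _) -eqmodE reprK.
rewrite /qdist; apply/eqP; rewrite eq_le; apply/andP; split.
- rewrite (le_trans (pdist_triangle D x _ _))// rE add0r.
  rewrite (le_trans (pdist_triangle D y _ _))// [X in _ + X]pdist_sym rE.
  by rewrite addr0.
- rewrite (le_trans (pdist_triangle D (repr (\pi_metric_quotient x)) _ _))//.
  rewrite pdist_sym rE add0r.
  rewrite (le_trans (pdist_triangle D (repr (\pi_metric_quotient y)) _ _))//.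
  by rewrite rE addr0.
Qed.

Lemma qdistxx x : qdist x x = 0. Proof. exact: pdistxx. Qed.

Lemma qdist_sym x y : qdist x y = qdist y x. Proof. exact: pdist_sym. Qed.

Lemma qdist_triangle y x z : qdist x z <= qdist x y + qdist y z.
Proof. exact: pdist_triangle. Qed.

Lemma qdist_eq0 x y : qdist x y = 0 -> x = y.
Proof.
move=> xy; rewrite -(reprK x) -(reprK y); apply/eqmodP.
by apply/eqP.
Qed.

HB.instance Definition _ := @isMetric.Build R metric_quotient qdist
  qdistxx qdist_eq0 qdist_sym qdist_triangle.

End MetricQuotient.

Section Coefficients.
Context {R : realType}.
Local Notation mu := (@lebesgue_measure R).
Local Notation I0pi := (`]0, pi[%classic : set R).

Definition L1_0pi : set (R -> R) :=
  [set q : R -> R | mu.-integrable I0pi (EFin \o q)].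

Definition L2_0pi : set (R -> R) :=
  [set f : R -> R | measurable_fun I0pi f /\
           mu.-integrable I0pi (fun x => (f x ^+ 2)%:E)].

Definition norm1 (f : R -> R) : R := \int[mu]_(x in I0pi) `|f x|.

(* Absolute continuity on [a, b]; the [n] intervals [x i, y i] are
   non-overlapping and listed from left to right. *)
Definition abs_continuous (a b : R) (f : R -> R) : Prop :=
  forall e, 0 < e -> exists2 d, 0 < d &
    forall (n : nat) (x y : nat -> R),
      (forall i, (i < n)%N -> a <= x i <= y i /\ y i <= b) ->
      (forall i, (i.+1 < n)%N -> y i <= x i.+1) ->
      \sum_(i < n) (y i - x i) < d ->
      \sum_(i < n) `|f (y i) - f (x i)| < e.

(* W_2^2[0, pi]: p and p' = p1 are absolutely continuous on [0, pi] and
   p'' = p2 is in L_2(0, pi). *)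
Definition W22_0pi : set (R -> R) :=
  [set p : R -> R | abs_continuous 0 pi p /\
    exists p1 p2 : R -> R,
      [/\ forall x : R, 0 < x < pi -> is_derive x 1 p (p1 x),
          abs_continuous 0 pi p1,
          {ae mu, forall x : R, 0 < x < pi -> is_derive x 1 p1 (p2 x)} &
          L2_0pi p2]].

(* Admissible coefficients of y'' + [l^2 - 2 l p(x) - q(x)] y = 0 on (0, pi). *)
Definition diffusion_coefs (p q : R -> R) : Prop := W22_0pi p /\ L1_0pi q.

Definition Omega_dif : set (R -> R) :=
  [set q : R -> R | exists p : R -> R, diffusion_coefs p q].

Lemma Omega_dif_L1 (q : R -> R) : Omega_dif q -> L1_0pi q.
Proof. by case=> p []. Qed.

End Coefficients.

Section Sequences.
Context {R : realType}.
Local Notation mu := (@lebesgue_measure R).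
Local Notation I0pi := (`]0, pi[%classic : set R).

(* [X n k] is X_k^n.  The indices are 3 <= n and 1 <= k <= n; outside this
   range the value is fixed to 0, so that equal families are equal functions. *)
Definition Sigma_dif : set (nat -> nat -> R) :=
  [set X : nat -> nat -> R | (forall n, (3 <= n)%N ->
              [/\ 0 < X n 1%N,
                  forall k, (1 <= k < n)%N -> X n k < X n k.+1 &
                  X n n <= pi]) /\
           (forall n k, ~~ [&& (3 <= n)%N, (1 <= k)%N & (k <= n)%N] ->
              X n k = 0)].

Definition grid_length (X : nat -> nat -> R) (n k : nat) : R :=
  X n k.+1 - X n k.

(* The intervals [X_k^n, X_(k+1)^n) are disjoint, so at most one summand is
   non-zero at a given x. *)
Definition Fdif (X : nat -> nat -> R) (p : R -> R) (n : nat) (x : R) : R :=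
  \sum_(1 <= k < n) \1_(`[X n k, X n k.+1[%classic) x *
    (n%:R * (2 * n%:R ^+ 2 * grid_length X n k - 2 * n%:R * pi - 2 * p x)).

Variant bcase := CaseI | CaseII.

Definition grid_point (c : bcase) (n k : nat) : R :=
  match c with
  | CaseI => (k%:R - 2^-1) * pi / n%:R
  | CaseII => k%:R * pi / n%:R
  end.

Definition in_case (c : bcase) (X : nat -> nat -> R) : Prop :=
  exists C : R, \forall n \near \oo, forall k, (1 <= k <= n)%N ->
    `|X n k - grid_point c n k| <= C / n%:R ^+ 2.

Definition quasinodal_with (X : nat -> nat -> R) (p q : R -> R) : Prop :=
  [/\ diffusion_coefs p q,
      (\int[mu]_(x in I0pi) `|Fdif X p n x - q x|%:E)%E
        @[n --> \oo] --> (0 : \bar R) &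
      exists c, in_case c X].

Definition quasinodal (X : nat -> nat -> R) (q : R -> R) : Prop :=
  exists p, quasinodal_with X p q.

Definition Sigma_dif1 : set (nat -> nat -> R) :=
  [set X : nat -> nat -> R | Sigma_dif X /\ exists2 q, Omega_dif q & quasinodal X q].

(* The convergence of [Fdif X p n] in L_1 forces 2n^2 L_k^n - 2n pi to converge
   to 2p in L_1(0, pi); so p is determined on [0, pi] by X, and the choice made
   by [xget] is immaterial. *)
Definition assoc_p (X : nat -> nat -> R) : R -> R :=
  xget (fun=> 0) [set p : R -> R | exists q : R -> R, quasinodal_with X p q].

Definition S_dif (X Y : nat -> nat -> R) (n : nat) : R :=
  n%:R ^+ 2 * pi *
    (\sum_(1 <= k < n) `|grid_length X n k - grid_length Y n k|) +
  n%:R * \int[mu]_(x in I0pi) `|assoc_p X x - assoc_p Y x|.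

Definition same_case (X Y : nat -> nat -> R) : Prop :=
  exists c, in_case c X /\ in_case c Y.

Definition d_Sigma (X Y : nat -> nat -> R) : R :=
  if `[< same_case X Y >]
  then limn_sup (fun n => S_dif X Y n / (1 + S_dif X Y n))
  else 1.

End Sequences.

Section PseudoMetrics.
Context {R : realType}.
Local Notation mu := (@lebesgue_measure R).
Local Notation I0pi := (`]0, pi[%classic : set R).

Lemma L1_0piB (f g : R -> R) :
  L1_0pi f -> L1_0pi g -> L1_0pi (fun x => f x - g x).
Proof.
move=> fi gi; rewrite /L1_0pi /=.
have -> : EFin \o (fun x => f x - g x) = ((EFin \o f) \- (EFin \o g))%E.
  by apply/funext => x.
by apply: integrableB => //; exact: measurable_itv.
Qed.

Lemma norm1_ge0 (f : R -> R) : 0 <= norm1 f.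
Proof. by apply: Rintegral_ge0. Qed.

Lemma norm1_sym (f g : R -> R) :
  norm1 (fun x => f x - g x) = norm1 (fun x => g x - f x).
Proof. by apply: eq_Rintegral => x _; rewrite distrC. Qed.

Lemma norm1xx (f : R -> R) : norm1 (fun x => f x - f x) = 0.
Proof.
rewrite /norm1; under eq_Rintegral do rewrite subrr normr0.
by rewrite Rintegral_cst ?mul0r//; exact: measurable_itv.
Qed.

Lemma norm1_triangle (g f h : R -> R) : L1_0pi f -> L1_0pi g -> L1_0pi h ->
  norm1 (fun x => f x - h x) <=
  norm1 (fun x => f x - g x) + norm1 (fun x => g x - h x).
Proof.
move=> fi gi hi.
have nI u : L1_0pi u -> mu.-integrable I0pi (EFin \o (fun x => `|u x|)).
  by move=> ui; exact: (integrable_norm ui).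
have mI : measurable I0pi by exact: measurable_itv.
have [fg gh fh] : [/\ L1_0pi (fun x => f x - g x), L1_0pi (fun x => g x - h x)
    & L1_0pi (fun x => f x - h x)] by split; exact: L1_0piB.
rewrite /norm1 -RintegralD//; [|exact: nI..].
apply: le_Rintegral => //; [exact: nI| |by move=> x _; exact: ler_distD].
rewrite (_ : _ \o _ = ((EFin \o (fun x => `|(f x - g x)%R|%R)) \+
  (EFin \o (fun x => `|(g x - h x)%R|%R)))%E); last by apply/funext.
by apply: integrableD => //; exact: nI.
Qed.

Lemma abs_continuous_within (a b : R) (f : R -> R) : abs_continuous a b f ->
  {within `[a, b], continuous f}.
Proof.
move=> fac; apply/subspace_continuousP => x /=; rewrite in_itv/= => /andP[ax xb].
apply/cvgrPdist_lt => e e0; have [d d0 fd] := fac e e0.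
rewrite near_withinE; near=> y => /=; rewrite in_itv/= => /andP[ay yb].
have xy : `|x - y| < d.
  by near: y; exact: (@nbhsx_ballx _ _ x _ d0).
have xyab (i : nat) : (i < 1)%N ->
    a <= Num.min x y <= Num.max x y /\ Num.max x y <= b.
  by case: (leP x y) => ? _; split=> //; rewrite ?ax ?ay//=; exact: ltW.
have := fd 1%N (fun=> Num.min x y) (fun=> Num.max x y) xyab.
rewrite !big_ord1 => /(_ (fun i => ltac:(by []))) h.
have {}h := h _; move: xy h; case: (leP x y) => ? xy h.
  by rewrite distrC h//; move: xy; rewrite ler0_norm; lra.
by rewrite h//; move: xy; rewrite ger0_norm; lra.
Unshelve. all: by end_near. Qed.

Lemma W22_L1 (p : R -> R) : W22_0pi p -> L1_0pi p.
Proof.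
move=> [/abs_continuous_within pc _]; rewrite /L1_0pi /=.
apply: (@integrableS _ _ _ mu `[0, pi]%classic).
- exact: measurable_itv.
- exact: measurable_itv.
- exact: subset_itv_oo_cc.
- by apply: continuous_compact_integrable => //; exact: segment_compact.
Qed.

Lemma assoc_p_L1 (X : nat -> nat -> R) : Sigma_dif1 X -> L1_0pi (assoc_p X).
Proof.
move=> [_ [q _ [p Xpq]]]; rewrite /assoc_p; case: xgetP => [r _ [q' [[]]]|].
  by move=> /W22_L1.
by move=> /(_ p) []; exists q.
Qed.

Lemma in_case_inj (c c' : bcase) (X : nat -> nat -> R) :
  in_case c X -> in_case c' X -> c = c'.
Proof.
wlog: c c' / c = CaseI /\ c' = CaseII.
  move=> wl; case: c; case: c' => // h h'; first exact: wl.
  by apply/esym; exact: wl.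
move=> [-> ->] [C XC] [C' XC'].
have : \forall n \near \oo, False; last by move=> /filter_ex[].
near=> n.
have n0 : (1 <= n)%N by near: n; exact: nbhs_infty_ge.
have nR0 : 0 < n%:R :> R by rewrite ltr0n.
have h1 : `|X n 1%N - grid_point CaseI n 1%N| <= C / n%:R ^+ 2.
  have : forall k, (1 <= k <= n)%N ->
    `|X n k - grid_point CaseI n k| <= C / n%:R ^+ 2 by near: n.
  by apply.
have h2 : `|X n 1%N - grid_point CaseII n 1%N| <= C' / n%:R ^+ 2.
  have : forall k, (1 <= k <= n)%N ->
    `|X n k - grid_point CaseII n k| <= C' / n%:R ^+ 2 by near: n.
  by apply.
have : `|grid_point CaseII n 1%N - grid_point CaseI n 1%N : R|
    <= (C + C') / n%:R ^+ 2.
  rewrite mulrDl (le_trans (ler_distD (X n 1%N) _ _))// addrC lerD//.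
  by rewrite distrC.
have -> : grid_point CaseII n 1%N - grid_point CaseI n 1%N = pi / 2 / n%:R :> R.
  by rewrite /grid_point; lra.
rewrite ger0_norm ?divr_ge0// ?pi_ge0// ler_pdivlMr ?exprn_gt0//.
rewrite expr2 mulrA divfK ?gt_eqF//.
have : (C + C') / (pi / 2) < n%:R by near: n; exact: nbhs_infty_gtr.
by rewrite ltr_pdivrMr ?divr_gt0 ?pi_gt0// mulrC => /lt_le_trans /[apply]; rewrite ltxx.
Unshelve. all: by end_near. Qed.

Lemma same_case_sym (X Y : nat -> nat -> R) : same_case X Y -> same_case Y X.
Proof. by move=> [c [? ?]]; exists c. Qed.

Lemma same_case_trans (Y X Z : nat -> nat -> R) :
  same_case X Y -> same_case Y Z -> same_case X Z.
Proof.
by move=> [c [cX cY]] [c' [c'Y c'Z]]; exists c; rewrite {2}(in_case_inj cY c'Y).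
Qed.

Lemma S_dif_ge0 (X Y : nat -> nat -> R) n : 0 <= S_dif X Y n.
Proof.
rewrite /S_dif addr_ge0// mulr_ge0//; last exact: norm1_ge0.
  by rewrite mulr_ge0 ?exprn_ge0// pi_ge0.
by rewrite sumr_ge0.
Qed.

Lemma S_dif_sym (X Y : nat -> nat -> R) n : S_dif X Y n = S_dif Y X n.
Proof.
rewrite /S_dif -!/(norm1 _) norm1_sym; congr (_ * _ + _).
by apply: eq_bigr => k _; rewrite distrC.
Qed.

Lemma S_difxx (X : nat -> nat -> R) n : S_dif X X n = 0.
Proof.
rewrite /S_dif -!/(norm1 _) norm1xx mulr0 addr0 big1 ?mulr0// => k _.
by rewrite subrr normr0.
Qed.

Lemma S_dif_triangle (Y X Z : nat -> nat -> R) n :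
  Sigma_dif1 X -> Sigma_dif1 Y -> Sigma_dif1 Z ->
  S_dif X Z n <= S_dif X Y n + S_dif Y Z n.
Proof.
move=> /assoc_p_L1 pX /assoc_p_L1 pY /assoc_p_L1 pZ.
rewrite /S_dif -!/(norm1 _) addrACA -!mulrDr; apply: lerD.
  rewrite ler_wpM2l ?mulr_ge0 ?exprn_ge0 ?pi_ge0// -big_split/=.
  by apply: ler_sum => k _; exact: ler_distD.
by rewrite ler_wpM2l//; exact: norm1_triangle.
Qed.

Let phi (s : R) := s / (1 + s).

Lemma phi_bound (s : R) : 0 <= s -> 0 <= phi s <= 1.
Proof.
move=> s0; have s1 : 0 < 1 + s by lra.
by rewrite /phi divr_ge0 ?(ltW s1)//= ler_pdivrMr//; lra.
Qed.

Lemma phi_triangle (s t u : R) : 0 <= s -> 0 <= t -> 0 <= u ->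
  s <= t + u -> phi s <= phi t + phi u.
Proof.
move=> s0 t0 u0 stu.
have E (v : R) : 0 <= v -> phi v = 1 - (1 + v)^-1.
  by move=> v0; rewrite /phi; field; lra.
have tu0 : 0 <= t + u by lra.
rewrite (@le_trans _ _ (phi (t + u)))//.
  by rewrite !E// lerB// lef_pV2 ?posrE; lra.
rewrite [leLHS]/phi mulrDl lerD// /phi ler_wpM2l// lef_pV2 ?posrE; lra.
Qed.

Lemma phi_S_bounded (X Y : nat -> nat -> R) :
  bounded_fun (fun n => phi (S_dif X Y n) : R^o).
Proof.
exists 1; split => // M M1 n _ /=.
have /andP[h0 h1] := phi_bound (S_dif_ge0 X Y n).
by rewrite ger0_norm// (le_trans h1)// ltW.
Qed.

Lemma le_limn_sup (u v : R^o^nat) : bounded_fun u -> bounded_fun v ->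
  (forall n, u n <= v n) -> limn_sup u <= limn_sup v.
Proof.
move=> bu bv uv; apply: ler_lim.
- apply: nonincreasing_is_cvgn; last exact: bounded_fun_has_lbound_sups.
  exact/nonincreasing_sups/bounded_fun_has_ubound.
- apply: nonincreasing_is_cvgn; last exact: bounded_fun_has_lbound_sups.
  exact/nonincreasing_sups/bounded_fun_has_ubound.
apply: nearW => n; apply: ge_sup; first by exists (u n); exists n => /=.
move=> _ [k /= nk <-]; rewrite (le_trans (uv k))//; apply: ub_le_sup.
  exact/has_ubound_sdrop/bounded_fun_has_ubound.
by exists k.
Qed.

Lemma limn_sup_cst (a : R) : limn_sup (fun=> a : R^o) = a.
Proof.
have [_ //] := @cvg_limn_inf_sup R (fun=> a : R^o) a (@cvg_cst _ _ _ _ _).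
Qed.

Lemma bounded_cst (a : R) : bounded_fun ((fun=> a) : R^o^nat).
Proof. by exists `|a|; split => // M aM n _ /=; exact: ltW. Qed.

Lemma d_Sigma_bound (X Y : nat -> nat -> R) : 0 <= d_Sigma X Y <= 1.
Proof.
rewrite /d_Sigma; case: asboolP => _; last by rewrite ler01 lexx.
have bS := phi_S_bounded X Y.
have b n := phi_bound (S_dif_ge0 X Y n).
apply/andP; split.
  rewrite -[leLHS]limn_sup_cst; apply: le_limn_sup => //; first exact: bounded_cst.
  by move=> n; have /andP[] := b n.
rewrite -[leRHS]limn_sup_cst; apply: le_limn_sup => //; first exact: bounded_cst.
by move=> n; have /andP[] := b n.
Qed.

Lemma d_Sigma_sym (X Y : nat -> nat -> R) : d_Sigma X Y = d_Sigma Y X.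
Proof.
rewrite /d_Sigma; have -> : S_dif X Y = S_dif Y X.
  by apply/funext => n; rewrite S_dif_sym.
have [XY|XY] := pselect (same_case X Y).
  by rewrite !asboolT//; exact: same_case_sym.
by rewrite !asboolF// => /same_case_sym.
Qed.

Lemma d_Sigmaxx (X : nat -> nat -> R) : Sigma_dif1 X -> d_Sigma X X = 0.
Proof.
move=> [_ [q _ [p [_ _ [c cX]]]]]; rewrite /d_Sigma asboolT; last by exists c.
rewrite -[RHS]limn_sup_cst; congr limn_sup; apply/funext => n.
by rewrite S_difxx mul0r.
Qed.

Lemma d_Sigma_diff (X Y : nat -> nat -> R) :
  ~ same_case X Y -> d_Sigma X Y = 1.
Proof. by move=> XY; rewrite /d_Sigma asboolF. Qed.

Lemma d_Sigma_same (X Y : nat -> nat -> R) : same_case X Y ->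
  d_Sigma X Y = limn_sup (fun n => S_dif X Y n / (1 + S_dif X Y n)).
Proof. by move=> XY; rewrite /d_Sigma asboolT. Qed.

Lemma d_Sigma_triangle (Y X Z : nat -> nat -> R) :
  Sigma_dif1 X -> Sigma_dif1 Y -> Sigma_dif1 Z ->
  d_Sigma X Z <= d_Sigma X Y + d_Sigma Y Z.
Proof.
move=> X1 Y1 Z1.
have /andP[XZ0 XZ1] := d_Sigma_bound X Z.
have /andP[XY0 XY1] := d_Sigma_bound X Y.
have /andP[YZ0 YZ1] := d_Sigma_bound Y Z.
have [XY|XY] := pselect (same_case X Y); last first.
  apply: (le_trans XZ1); apply: (@le_trans _ _ (d_Sigma X Y)).
    by rewrite (d_Sigma_diff XY).
  exact: (ler_wpDr YZ0 (lexx _)).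
have [YZ|YZ] := pselect (same_case Y Z); last first.
  apply: (le_trans XZ1); apply: (@le_trans _ _ (d_Sigma Y Z)).
    by rewrite (d_Sigma_diff YZ).
  exact: (ler_wpDl XY0 (lexx _)).
rewrite (d_Sigma_same XY) (d_Sigma_same YZ).
rewrite (d_Sigma_same (same_case_trans XY YZ)).
apply: le_trans (le_limn_supD (phi_S_bounded X Y) (phi_S_bounded Y Z)).
apply: le_limn_sup; [exact: phi_S_bounded| |].
  by apply: bounded_funD; exact: phi_S_bounded.
move=> n; apply: phi_triangle; [exact: S_dif_ge0..|].
exact: S_dif_triangle.
Qed.

Definition Omega_pseudodist : pseudodist R (@Omega_dif R) :=
  @PseudoDist R (@Omega_dif R)
    (fun q q' => norm1 (fun x => val q x - val q' x))
    (fun q => norm1xx (val q))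
    (fun q q' => norm1_ge0 _)
    (fun q q' => norm1_sym (val q) (val q'))
    (fun q' q q'' => norm1_triangle (Omega_dif_L1 (set_valP q))
       (Omega_dif_L1 (set_valP q')) (Omega_dif_L1 (set_valP q''))).

Definition Sigma_pseudodist : pseudodist R (@Sigma_dif1 R) :=
  @PseudoDist R (@Sigma_dif1 R)
    (fun X Y => d_Sigma (val X) (val Y))
    (fun X => d_Sigmaxx (set_valP X))
    (fun X Y => proj1 (andP (d_Sigma_bound (val X) (val Y))))
    (fun X Y => d_Sigma_sym (val X) (val Y))
    (fun Y X Z => d_Sigma_triangle (set_valP X) (set_valP Y) (set_valP Z)).

End PseudoMetrics.

(* Functions of Omega_dif are identified when they agree almost everywhere on
   (0, pi), i.e. when ||q - q'||_1 = 0. *)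
Definition Omega_space (R : realType) : metricType R :=
  metric_quotient (@Omega_pseudodist R).

Definition Sigma_space (R : realType) : metricType R :=
  metric_quotient (@Sigma_pseudodist R).

(* The classes of the double sequences belonging to the case [c].  Classes of
   different cases are at distance 1, so [Sigma_space] is the disjoint union of
   two non-empty open parts, whereas [Omega_space], a normed space, is
   connected; it is with each part that [Omega_space] is to be compared. *)
Definition Sigma_part (R : realType) (c : bcase) : set (Sigma_space R) :=
  [set (\pi_(metric_quotient (@Sigma_pseudodist R)) X)%qT |
     X in [set X : @Sigma_dif1 R | in_case c (val X)]].

(* Main.v *)
Require Import Defs.
From mathcomp Require Import all_boot all_order all_algebra.
From mathcomp Require Import all_classical all_reals all_analysis measurable_realfun.
From mathcomp Require Import ring lra zify.

Set Implicit Arguments.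
Unset Strict Implicit.
Unset Printing Implicit Defensive.

Import Order.TTheory GRing.Theory Num.Theory.
Import numFieldNormedType.Exports.

Local Open Scope classical_set_scope.
Local Open Scope ring_scope.

(** The nodes of a quasinodal sequence are so close to the uniform ones that the
    associated function has to vanish. The deviations of the grid lengths from
    [pi / n], multiplied by [n^2], converge to [p] in L1; but their sum over
    consecutive cells telescopes to [n^2] times a difference of two node errors
    O(1/n^2), so it stays bounded, and the integral of [p] over a fixed interval
    is O(1/n), hence 0 ([int_cell_assoc_p]). As the cell averages of an
    integrable function converge to it ([avg_cvg]), [p] is null
    ([norm1_assoc0]), and the term with the associated functions disappears from
    the distance.

    With [p = 0] the functions of the convergence condition are step functions
    on the grids [X n]. Carrying their values over to the uniform grid of the
    case changes them by o(1) in L1, because every node moves by O(1/n^2) while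
    the absolute values add up to O(n) ([uniform_step_cvg]). For two sequences of
    the same case the difference of the transported step functions lives on
    cells of equal length, so its norm is exactly twice [S_dif] ([S_difE]). Hence
    [S_dif X Y n] tends to half of [N], the norm of [q - r], and [d_Sigma X Y] is
    [N / (2 + N)] ([d_SigmaE]); solving for [N] gives the formula.

    The averages and the transport between grids also give, for every integrable [q], a quasinodal
    sequence of either case with [p = 0]: the uniform grid with its [k]-th cell
    lengthened by [1 / (2 n^3)] times the average of [q] over that cell
    ([nodal_seq]). So passing from a potential to the class of its sequences is a
    bijection that changes distances by [t |-> t / (2 + t)], and therefore a
    homeomorphism ([homeomorphic_dist]). *)

(** * Integrable functions on the interval from 0 to pi *)

Section L1Space.
Context {R : realType}.
Local Notation mu := (@lebesgue_measure R).
Local Notation I0pi := (`]0, pi[%classic : set R).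
Implicit Types f g h : R -> R.

Definition int0pi f : R := \int[mu]_(x in I0pi) f x.

Lemma measurable_I0pi : measurable I0pi.
Proof. exact: measurable_itv. Qed.

Lemma lebesgue_I0pi : mu I0pi = pi%:E.
Proof. by rewrite lebesgue_measure_itv/= lte_fin pi_gt0 -EFinB subr0. Qed.

Hint Resolve measurable_I0pi : core.

Lemma L1_0pi_cst (r : R) : L1_0pi (cst r).
Proof.
apply/integrableP; split; first exact/measurable_EFinP/measurable_cst.
by rewrite (eq_integral (cst `|r|%:E))// integral_cst//= lebesgue_I0pi -EFinM ltry.
Qed.

Lemma L1_0piD f g : L1_0pi f -> L1_0pi g -> L1_0pi (fun x => f x + g x).
Proof.
move=> fi gi; rewrite /L1_0pi /=.
have -> : EFin \o (fun x => f x + g x) = ((EFin \o f) \+ (EFin \o g))%E by [].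
exact: integrableD.
Qed.

Lemma L1_0piZ (r : R) f : L1_0pi f -> L1_0pi (fun x => r * f x).
Proof.
move=> fi; rewrite /L1_0pi /=.
have -> : EFin \o (fun x => r * f x) = (fun x => r%:E * (EFin \o f) x)%E by [].
exact: integrableZl.
Qed.

Lemma L1_0pi_abs f : L1_0pi f -> L1_0pi (fun x => `|f x|).
Proof. by move=> fi; exact: (integrable_norm fi). Qed.

Lemma L1_0pi_indicM (E : set R) f : measurable E ->
  L1_0pi f -> L1_0pi (fun x => \1_E x * f x).
Proof.
move=> mE fi; rewrite /L1_0pi /=; have /measurable_int/measurable_EFinP fm := fi.
apply: (le_integrable _ _ _ fi) => //.
  by apply/measurable_EFinP; exact: measurable_funM.
move=> x _ /=; rewrite lee_fin normrM ler_piMl// indicE.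
by case: (_ \in _); rewrite ?normr1 ?normr0.
Qed.

Lemma L1_0pi_indic (E : set R) : measurable E -> L1_0pi (\1_E : R -> R).
Proof.
move=> mE; have := L1_0pi_indicM mE (L1_0pi_cst 1).
by congr L1_0pi; apply/funext => x; rewrite mulr1.
Qed.

Lemma L1_0pi_sum (m n : nat) (f : nat -> R -> R) :
  (forall k, L1_0pi (f k)) -> L1_0pi (fun x => \sum_(m <= k < n) f k x).
Proof.
move=> fi; elim: (index_iota m n) => [|k s ih].
  have := L1_0pi_cst 0; congr L1_0pi; apply/funext => x.
  by rewrite big_nil.
have := L1_0piD (fi k) ih; congr L1_0pi; apply/funext => x.
by rewrite big_cons.
Qed.

Lemma int0piD f g : L1_0pi f -> L1_0pi g ->
  int0pi (fun x => f x + g x) = int0pi f + int0pi g.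
Proof. by move=> fi gi; rewrite /int0pi RintegralD. Qed.

Lemma int0piB f g : L1_0pi f -> L1_0pi g ->
  int0pi (fun x => f x - g x) = int0pi f - int0pi g.
Proof. by move=> fi gi; rewrite /int0pi RintegralB. Qed.

Lemma int0piZr (r : R) f : L1_0pi f -> int0pi (fun x => f x * r) = int0pi f * r.
Proof. by move=> fi; rewrite /int0pi RintegralZr. Qed.

Lemma int0pi_cst (r : R) : int0pi (fun=> r) = r * pi.
Proof.
rewrite /int0pi Rintegral_cst//; congr (_ * _).
exact: (congr1 fine lebesgue_I0pi).
Qed.

Lemma int0pi_sum (m n : nat) (f : nat -> R -> R) : (forall k, L1_0pi (f k)) ->
  int0pi (fun x => \sum_(m <= k < n) f k x) = \sum_(m <= k < n) int0pi (f k).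
Proof.
move=> fi; have [mn|nm] := leqP m n; last first.
  rewrite [RHS]big_geq ?(ltnW nm)//.
  under [X in int0pi X]eq_fun do rewrite big_geq ?(ltnW nm)//.
  by rewrite int0pi_cst mul0r.
rewrite -(subnKC mn); elim: (n - m)%N => [|j ih].
  rewrite addn0 [RHS]big_geq//.
  under [X in int0pi X]eq_fun do rewrite big_geq//.
  by rewrite int0pi_cst mul0r.
rewrite addnS big_nat_recr ?leq_addr//= -ih -int0piD//; last exact: L1_0pi_sum.
by congr int0pi; apply/funext => x; rewrite big_nat_recr ?leq_addr.
Qed.

Lemma eq_int0pi f g : (forall x, 0 < x < pi -> f x = g x) -> int0pi f = int0pi g.
Proof.
by move=> fg; apply: eq_Rintegral => x /set_mem/=; rewrite in_itv/=; exact: fg.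
Qed.

Lemma le_int0pi f g : L1_0pi f -> L1_0pi g ->
  (forall x, 0 < x < pi -> f x <= g x) -> int0pi f <= int0pi g.
Proof.
by move=> fi gi fg; apply: le_Rintegral => // x /=; rewrite in_itv/=; exact: fg.
Qed.

Lemma int0pi_abs f : int0pi (fun x => `|f x|) = norm1 f.
Proof. by []. Qed.

Lemma norm_int0pi f : L1_0pi f -> `|int0pi f| <= norm1 f.
Proof. by move=> fi; exact: le_normr_Rintegral. Qed.

Lemma norm1_le f g : L1_0pi f -> L1_0pi g ->
  (forall x, 0 < x < pi -> `|f x| <= g x) -> norm1 f <= int0pi g.
Proof. by move=> fi gi fg; apply: le_int0pi => //; exact: L1_0pi_abs. Qed.

Lemma norm1D f g : L1_0pi f -> L1_0pi g ->
  norm1 (fun x => f x + g x) <= norm1 f + norm1 g.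
Proof.
move=> fi gi; rewrite -!int0pi_abs -int0piD; [|exact: L1_0pi_abs..].
apply: norm1_le; first exact: L1_0piD.
  by apply: L1_0piD; exact: L1_0pi_abs.
by move=> x _; exact: ler_normD.
Qed.

Lemma norm1Zl (r : R) f : L1_0pi f -> norm1 (fun x => r * f x) = `|r| * norm1 f.
Proof.
move=> fi; rewrite mulrC -!int0pi_abs -int0piZr; last exact: L1_0pi_abs.
by apply: eq_int0pi => x _; rewrite normrM mulrC.
Qed.

Lemma norm1_sum (m n : nat) (f : nat -> R -> R) : (forall k, L1_0pi (f k)) ->
  norm1 (fun x => \sum_(m <= k < n) f k x) <= \sum_(m <= k < n) norm1 (f k).
Proof.
move=> fi; under eq_bigr do rewrite -int0pi_abs.
have fai k : L1_0pi (fun x => `|f k x|) by exact: L1_0pi_abs.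
rewrite -int0pi_sum//; apply: norm1_le; [exact: L1_0pi_sum..|].
by move=> x _; exact: ler_norm_sum.
Qed.

Lemma integral_abs_norm1 f : L1_0pi f ->
  (\int[mu]_(x in I0pi) `|f x|%:E)%E = (norm1 f)%:E.
Proof.
move=> fi; rewrite /norm1 /Rintegral fineK//.
by apply: integrable_fin_num => //; exact: (L1_0pi_abs fi).
Qed.

Lemma int0pi_indic (u v : R) : 0 < u -> u <= v -> v <= pi ->
  int0pi \1_(`[u, v[) = v - u.
Proof.
move=> u0 uv vpi; have muv : mu (`[u, v[%classic : set R) = (v - u)%:E.
  rewrite lebesgue_measure_itv/= lte_fin; have [//|vu] := ltP u v.
  by have -> : v = u; [lra|rewrite subrr].
rewrite /int0pi /Rintegral integral_indic// setIidl; first exact: (congr1 fine muv).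
move=> x /=; rewrite !in_itv/= => /andP[ux xv].
by rewrite (lt_le_trans u0 ux) (lt_le_trans xv vpi).
Qed.

End L1Space.
#[global] Hint Resolve measurable_I0pi : core.

(** * Step functions on a grid *)

Section StepFunctions.
Context {R : realType}.
Implicit Types (g h a b : nat -> R) (n k : nat).

Definition step g a n (x : R) : R :=
  \sum_(1 <= k < n) \1_(`[g k, g k.+1[) x * a k.

Definition grid n g : Prop :=
  [/\ 0 < g 1%N, forall k, (1 <= k < n)%N -> g k <= g k.+1 & g n <= pi].

Lemma indic_co (u v x : R) : \1_(`[u, v[) x = ((u <= x < v)%R)%:R :> R.
Proof.
by rewrite indicE; congr (nat_of_bool _)%:R; rewrite mem_setE in_itv.
Qed.

Lemma grid_le n g k l : grid n g -> (1 <= k <= l)%N -> (l <= n)%N -> g k <= g l.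
Proof.
move=> [_ gm _] /andP[k1]; elim: l => [|l ih].
  by rewrite leqn0 => /eqP->.
rewrite leq_eqVlt => /predU1P[->//|]; rewrite ltnS => kl ln.
by rewrite (le_trans (ih kl (ltnW ln)))// gm// (leq_trans k1 kl).
Qed.

Lemma grid_bounds n g k : grid n g -> (1 <= k <= n)%N -> 0 < g k <= pi.
Proof.
move=> gn /andP[k1 kn]; have [g1 _ gpi] := gn.
rewrite (lt_le_trans g1) ?(grid_le gn)//=.
by apply: le_trans gpi; apply: (grid_le gn); rewrite ?k1 ?leqnn.
Qed.

Lemma L1_step g a n : L1_0pi (step g a n).
Proof.
apply: L1_0pi_sum => k.
have := L1_0pi_indicM (measurable_itv `[g k, g k.+1[) (L1_0pi_cst (a k)).
by [].
Qed.

Lemma stepB g a b n x : step g a n x - step g b n x =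
  step g (fun k => a k - b k) n x.
Proof.
by rewrite /step -sumrB; apply: eq_bigr => k _; rewrite mulrBr.
Qed.

Lemma stepZ g a n r x : step g (fun k => r * a k) n x = r * step g a n x.
Proof. by rewrite /step mulr_sumr; apply: eq_bigr => k _; rewrite mulrCA. Qed.

(** The cells of a grid are disjoint, so only one summand survives. *)
Lemma step_cell g a n k x : grid n g -> (1 <= k < n)%N -> g k <= x < g k.+1 ->
  step g a n x = a k.
Proof.
move=> gn kn /andP[kx xk]; have /andP[k1 kn'] := kn.
rewrite /step (bigD1_seq k) ?iota_uniq ?mem_index_iota//=.
rewrite indic_co kx xk mul1r big_nat_cond big1 ?addr0// => l.
rewrite indic_co => /andP[/andP[l1 ln] lk].
case: ltngtP lk => // lk _.
  have : g l.+1 <= g k by apply: (grid_le gn) => //; exact: ltnW.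
  by case: (ltP x (g l.+1)); rewrite ?andbF ?mul0r// => *; lra.
have : g k.+1 <= g l by apply: (grid_le gn) => //; exact: ltnW.
by case: (leP (g l) x); rewrite ?mul0r// => *; lra.
Qed.

Lemma step_out g a n x :
  (forall k, (1 <= k < n)%N -> ~~ (g k <= x < g k.+1)) -> step g a n x = 0.
Proof.
move=> gx; rewrite /step big_nat_cond big1// => k /andP[kn _].
by rewrite indic_co (negbTE (gx _ kn)) mul0r.
Qed.

Lemma step_case g n x : grid n g ->
  (exists2 k, (1 <= k < n)%N & g k <= x < g k.+1) \/
  (forall k, (1 <= k < n)%N -> ~~ (g k <= x < g k.+1)).
Proof.
move=> gn.
have [?|h] := pselect (exists2 k, (1 <= k < n)%N & g k <= x < g k.+1); first by left.
by right => k kn; apply/negP => kx; apply: h; exists k.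
Qed.

Lemma step_norm g a n x : grid n g ->
  `|step g a n x| = step g (fun k => `|a k|) n x.
Proof.
move=> gn; have [[k kn kx]|xo] := step_case x gn; first by rewrite !(step_cell _ gn kn kx).
by rewrite !(step_out _ xo) normr0.
Qed.

Lemma int0pi_step g a n : grid n g ->
  int0pi (step g a n) = \sum_(1 <= k < n) (g k.+1 - g k) * a k.
Proof.
move=> gn; have ii k : L1_0pi (\1_(`[g k, g k.+1[) : R -> R).
  by apply: L1_0pi_indic; exact: measurable_itv.
rewrite int0pi_sum; last first.
  move=> k; have := L1_0piZ (a k) (ii k).
  by congr L1_0pi; apply/funext => x; rewrite mulrC.
apply: eq_big_nat => k kn; rewrite int0piZr//; have /andP[k1 kn'] := kn.
have /andP[gk0 _] : 0 < g k <= pi by apply: (grid_bounds gn); rewrite k1 ltnW.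
have /andP[_ gkpi] : 0 < g k.+1 <= pi by apply: (grid_bounds gn).
by have [_ gm _] := gn; rewrite int0pi_indic// gm.
Qed.

Lemma norm1_step g a n : grid n g ->
  norm1 (step g a n) = \sum_(1 <= k < n) (g k.+1 - g k) * `|a k|.
Proof.
move=> gn; rewrite -int0pi_step// -int0pi_abs; apply: eq_int0pi => x _.
exact: step_norm.
Qed.

(** The two indicators differ only between [u] and [u'] or between [v] and
    [v']. *)
Lemma indic_coB (u v u' v' x : R) : u <= v -> u' <= v' ->
  `|\1_(`[u, v[) x - \1_(`[u', v'[) x : R| <=
  \1_(`[Num.min u u', Num.max u u'[) x + \1_(`[Num.min v v', Num.max v v'[) x.
Proof.
move=> uv uv'; rewrite !indic_co.
case: (leP u u') => ?; case: (leP v v') => ?;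
case: (leP u x) => ?; case: (leP u' x) => ?; case: (ltP x v) => ?; case: (ltP x v') => ? /=;
  rewrite ?(subrr, subr0, sub0r, normrN, normr0, normr1, addr0, add0r); lra.
Qed.

Lemma norm1_indic_coB (u v u' v' d : R) :
  0 < u -> u <= v -> v <= pi -> 0 < u' -> u' <= v' -> v' <= pi ->
  `|u - u'| <= d -> `|v - v'| <= d ->
  norm1 (fun x => \1_(`[u, v[) x - \1_(`[u', v'[) x) <= 2 * d.
Proof.
move=> u0 uv vpi u0' uv' vpi' uu vv.
have ii s t : L1_0pi (\1_(`[s, t[) : R -> R).
  by apply: L1_0pi_indic; exact: measurable_itv.
apply: (@le_trans _ _ (int0pi (fun x => \1_(`[Num.min u u', Num.max u u'[) x +
    \1_(`[Num.min v v', Num.max v v'[) x))).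
  apply: norm1_le; [exact: L1_0piB|exact: L1_0piD|].
  by move=> x _; exact: indic_coB.
rewrite int0piD//.
have mm (s t : R) : 0 < s -> 0 < t -> s <= pi -> t <= pi -> `|s - t| <= d ->
    int0pi \1_(`[Num.min s t, Num.max s t[) <= d.
  move=> s0 t0 spi tpi; rewrite ler_norml => /andP[? ?].
  by rewrite int0pi_indic; case: (leP s t); lra.
by rewrite mulrDl mul1r lerD// mm//; lra.
Qed.

(** Each cell has two ends, and each end sweeps a set of measure at most [d]. *)
Lemma norm1_regrid g h a n (d : R) : grid n g -> grid n h ->
  (forall k, (1 <= k <= n)%N -> `|g k - h k| <= d) ->
  norm1 (fun x => step g a n x - step h a n x) <=
  2 * d * \sum_(1 <= k < n) `|a k|.
Proof.
move=> gn hn gh.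
have ii s t : L1_0pi (\1_(`[s, t[) : R -> R).
  by apply: L1_0pi_indic; exact: measurable_itv.
have -> : (fun x => step g a n x - step h a n x) = fun x =>
    \sum_(1 <= k < n) a k * (\1_(`[g k, g k.+1[) x - \1_(`[h k, h k.+1[) x).
  apply/funext => x; rewrite /step -sumrB; apply: eq_bigr => k _; ring.
apply: le_trans (norm1_sum _ _ _) _.
  by move=> k; apply: L1_0piZ; exact: L1_0piB.
rewrite mulr_sumr; apply: ler_sum_nat => k /andP[k1 kn].
rewrite norm1Zl; last exact: L1_0piB.
rewrite mulrC ler_wpM2r//.
have [_ gm _] := gn; have [_ hm _] := hn.
have kk : (1 <= k <= n)%N by rewrite k1 ltnW.
have kk1 : (1 <= k < n)%N by rewrite k1.
have /andP[g1 g2] := grid_bounds gn kk.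
have /andP[g3 g4] : 0 < g k.+1 <= pi by exact: grid_bounds gn _.
have /andP[h1 h2] := grid_bounds hn kk.
have /andP[h3 h4] : 0 < h k.+1 <= pi by exact: grid_bounds hn _.
by apply: norm1_indic_coB => //; [exact: gm|exact: hm|exact: gh|exact: gh].
Qed.

End StepFunctions.

(** * Cell averages *)

Section CellAverages.
Context {R : realType}.
Implicit Types (f g : R -> R) (c : bcase) (n k : nat).

Lemma grid_pointS c n k :
  grid_point c n k.+1 - grid_point c n k = pi / n%:R :> R.
Proof. by case: c; rewrite /grid_point -natr1; ring. Qed.

Lemma grid_point_ge c n k : (0 < n)%N -> (1 <= k)%N ->
  pi / 2 / n%:R <= grid_point c n k :> R.
Proof.
move=> n0 k1; have pi0 := pi_gt0 R; have k1R : 1 <= k%:R :> R by rewrite ler1n.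
by case: c => /=; rewrite ler_pM2r ?invr_gt0 ?ltr0n//; nra.
Qed.

Lemma grid_point_gt0 c n k : (0 < n)%N -> (1 <= k)%N ->
  0 < grid_point c n k :> R.
Proof.
move=> n0 k1; apply: lt_le_trans (grid_point_ge c n0 k1).
by rewrite !divr_gt0 ?pi_gt0 ?ltr0n.
Qed.

Lemma grid_point_le_pi c n : (0 < n)%N -> grid_point c n n <= pi :> R.
Proof.
move=> n0; have pi0 := pi_gt0 R.
by case: c => /=; rewrite ler_pdivrMr ?ltr0n//; nra.
Qed.

Lemma grid_point_grid c n : (0 < n)%N -> grid n (grid_point c n : nat -> R).
Proof.
move=> n0; split; [exact: grid_point_gt0| |exact: grid_point_le_pi].
by move=> k _; rewrite -subr_ge0 grid_pointS divr_ge0 ?pi_ge0.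
Qed.

Lemma norm1_uniform_step c n (a : nat -> R) : (0 < n)%N ->
  norm1 (step (grid_point c n) a n) = pi / n%:R * \sum_(1 <= k < n) `|a k|.
Proof.
move=> n0; rewrite norm1_step; last exact: grid_point_grid.
by rewrite mulr_sumr; apply: eq_bigr => k _; rewrite grid_pointS.
Qed.

Definition cell c n k : set R := `[grid_point c n k, grid_point c n k.+1[%classic.

Definition cell_avg c n f k : R :=
  n%:R / pi * int0pi (fun x => \1_(cell c n k) x * f x).

Definition avg c n f : R -> R := step (grid_point c n) (cell_avg c n f) n.

Lemma measurable_cell c n k : measurable (cell c n k).
Proof. exact: measurable_itv. Qed.
Hint Resolve measurable_cell : core.

Lemma step_le1 (h : nat -> R) n x : grid n h -> 0 <= step h (fun=> 1) n x <= 1.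
Proof.
move=> hn; have [[k kn kx]|xo] := step_case x hn.
  by rewrite (step_cell _ hn kn kx) ler01 lexx.
by rewrite (step_out _ xo) ler01 lexx.
Qed.

Lemma step1E (h : nat -> R) n x : grid n h -> (0 < n)%N ->
  step h (fun=> 1) n x = \1_(`[h 1%N, h n[%classic) x.
Proof.
move=> hn n0; rewrite indic_co; have [[k kn kx]|xo] := step_case x hn.
  rewrite (step_cell _ hn kn kx); have /andP[k1 kn'] := kn.
  have : h 1%N <= h k by apply: (grid_le hn); [rewrite k1|exact: ltnW].
  have : h k.+1 <= h n by apply: (grid_le hn).
  by move=> knle h1k; have -> : h 1%N <= x < h n by lra.
rewrite (step_out _ xo); case: ltP; rewrite ?andbF// => xn.
case: leP => // h1x.
have hx k : (1 <= k)%N -> (k <= n)%N -> h k <= x.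
  elim: k => // -[|k] ih _ kn; first by [].
  have := xo k.+1; rewrite kn ih ?(ltnW kn)//= => /(_ isT).
  by rewrite -leNgt.
by have := hx n n0 (leqnn n); rewrite leNgt xn.
Qed.

Lemma sum_cell_avg c n f : (0 < n)%N -> L1_0pi f ->
  pi / n%:R * \sum_(1 <= k < n) `|cell_avg c n f k| <= norm1 f.
Proof.
move=> n0 fi; have pi0 := pi_gt0 R; have nR : 0 < n%:R :> R by rewrite ltr0n.
have ci k : L1_0pi (fun x => \1_(cell c n k) x * f x) by exact: L1_0pi_indicM.
apply: (@le_trans _ _ (\sum_(1 <= k < n) norm1 (fun x => \1_(cell c n k) x * f x))).
  rewrite mulr_sumr ler_sum// => k _; rewrite /cell_avg normrM.
  rewrite ger0_norm ?divr_ge0 ?pi_ge0// mulrA.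
  rewrite (_ : pi / n%:R * (n%:R / pi) = 1) ?mul1r; first exact: norm_int0pi.
  by rewrite mulrA divfK ?mulfV ?gt_eqF.
have cai k : L1_0pi (fun x => `|\1_(cell c n k) x * f x|) by exact: L1_0pi_abs.
under eq_bigr do rewrite -int0pi_abs.
rewrite -int0pi_sum// -int0pi_abs; apply: le_int0pi.
- exact: L1_0pi_sum.
- exact: L1_0pi_abs.
move=> x _; have gn := @grid_point_grid c n n0.
have /andP[s0 s1] := step_le1 x gn.
apply: (@le_trans _ _ (step (grid_point c n) (fun=> 1) n x * `|f x|)).
  rewrite /step mulr_suml ler_sum// => k _.
  by rewrite mulr1 normrM ger0_norm// indicE.
by rewrite ler_piMl.
Qed.

(** Averaging contracts L1: the cells are disjoint parts of the interval. *)
Lemma norm1_avg c n f : (0 < n)%N -> L1_0pi f -> norm1 (avg c n f) <= norm1 f.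
Proof. by move=> n0 fi; rewrite norm1_uniform_step//; exact: sum_cell_avg. Qed.

Lemma avgB c n f g x : L1_0pi f -> L1_0pi g ->
  avg c n f x - avg c n g x = avg c n (fun y => f y - g y) x.
Proof.
move=> fi gi; rewrite stepB /avg; congr step; apply/funext => k.
rewrite /cell_avg -mulrBr -int0piB; [|exact: L1_0pi_indicM..].
by congr (_ * int0pi _); apply/funext => y; rewrite mulrBr.
Qed.

(** Heine--Cantor on the segment, at the scale of the cells; [y] may leave the
    segment, as [g] is continuous on the whole line. *)
Lemma unif_cont_0pi g e : continuous g -> 0 < e -> \forall n \near \oo,
  forall x y, 0 <= x <= pi -> `|x - y| <= pi / n%:R -> `|g x - g y| <= e.
Proof.
move=> gc e0; have /compact_near_coveringP cov := @segment_compact R 0 pi.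
have : \forall n \near \oo, `[0, pi]%classic `<=`
    (fun x => forall y, `|x - y| <= pi / n%:R -> `|g x - g y| <= e).
  apply: cov => x _.
  have /cvgrPdist_lt/(_ (e / 2)) := gc x; rewrite divr_gt0// => /(_ isT).
  move=> /nbhs_ballP[d /= d0 xd].
  have d20 : 0 < d / 2 by rewrite divr_gt0.
  exists (ball x (d / 2), [set n : nat | pi / (d / 2) < n%:R]) => /=.
    by split; [exact: nbhsx_ballx|exact: nbhs_infty_gtr].
  move=> [x' n] /= [xx' nd] y x'y.
  have nR : 0 < n%:R :> R by apply: lt_trans nd; rewrite divr_gt0 ?pi_gt0.
  have x'yd : `|x' - y| < d / 2.
    by apply: le_lt_trans x'y _; rewrite ltr_pdivrMr// mulrC -ltr_pdivrMr.
  have h1 : `|g x - g x'| < e / 2.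
    by apply: xd; apply: lt_trans xx' _; lra.
  have h2 : `|g x - g y| < e / 2.
    apply: xd; rewrite /ball/=; apply: le_lt_trans (ler_distD x' _ _) _.
    by move: xx'; rewrite /ball/=; lra.
  have := ler_distD (g x) (g x') (g y); rewrite (distrC (g x') (g x)); lra.
by apply: filterS => n h x y xI; apply: h; rewrite /= in_itv.
Qed.

Lemma dominated_norm1_cvg (u : nat -> R -> R) : (forall n, L1_0pi (u n)) ->
  (forall x, 0 < x < pi -> u n x @[n --> \oo] --> 0) ->
  forall f, L1_0pi f -> (forall n x, `|u n x| <= `|f x|) ->
  norm1 (u n) @[n --> \oo] --> 0.
Proof.
move=> ui u0 f fi uf.
have [] := @dominated_convergence _ _ _ (@lebesgue_measure R) _ (@measurable_I0pi R)
  (fun n => EFin \o u n) (cst 0%E) (fun x => `|f x|%:E).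
- by move=> n; exact: (measurable_int _ (ui n)).
- exact: measurable_cst.
- apply: aeW => x /=; rewrite in_itv/= => xI; apply: cvg_EFin.
    by apply: nearW => n.
  exact: u0.
- exact: (L1_0pi_abs fi).
- by apply: aeW => x n _; rewrite lee_fin.
move=> _ /fine_cvg h _; apply: cvg_trans h; apply: near_eq_cvg; apply: nearW => n.
by congr fine; apply: eq_integral => x _; rewrite [cst _ _]/cst sube0.
Qed.

(** The gaps left at both ends of the interval are negligible in the limit. *)
Lemma norm1_indic_cvg (u v : nat -> R) f : L1_0pi f ->
  u n @[n --> \oo] --> 0 -> v n @[n --> \oo] --> (pi : R) ->
  norm1 (fun x => \1_(`[u n, v n[%classic) x * f x - f x) @[n --> \oo] --> 0.
Proof.
move=> fi u0 vpi; apply: (@dominated_norm1_cvg _ _ _ f fi).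
- by move=> n; apply: L1_0piB => //; apply: L1_0pi_indicM => //; exact: measurable_itv.
- move=> x /andP[x0 xpi]; apply/cvgrPdist_lt => e e0; near=> n.
  rewrite indic_co (_ : u n <= x < v n) ?mul1r ?subrr ?subr0 ?normr0//.
  apply/andP; split; near: n.
    by apply: (cvgr_le _ u0).
  by apply: (cvgr_gt _ vpi).
- move=> n x; rewrite indic_co; case: (_ <= x < _) => /=.
    by rewrite mul1r subrr normr0.
  by rewrite mul0r sub0r normrN.
Unshelve. all: by end_near. Qed.

Lemma cvg_div_nat (r : R) : r / n%:R @[n --> \oo] --> 0.
Proof.
rewrite -[X in _ --> X](mulr0 r); apply: cvgMr.
rewrite -(cvg_shiftS (fun n => n%:R^-1 : R)); exact: cvg_harmonic.
Qed.

Lemma grid_point1_cvg c : grid_point c n 1 @[n --> \oo] --> (0 : R).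
Proof.
by case: c; exact: cvg_div_nat.
Qed.

Lemma grid_pointn_cvg c : grid_point c n n @[n --> \oo] --> (pi : R).
Proof.
apply/cvgrPdist_le => e e0; near=> n.
have n0 : (0 < n)%N by near: n; exact: nbhs_infty_gt.
have nR : 0 < n%:R :> R by rewrite ltr0n.
have : pi / e < n%:R by near: n; exact: nbhs_infty_gtr.
rewrite ltr_pdivrMr// => h; have pi0 := pi_gt0 R.
have -> : pi - grid_point c n n = (if c is CaseI then 2^-1 * pi / n%:R else 0) :> R.
  by case: c => /=; field; rewrite gt_eqF.
case: c; last by rewrite normr0 ltW.
rewrite ger0_norm ?divr_ge0 ?mulr_ge0 ?pi_ge0// ler_pdivrMr//; lra.
Unshelve. all: by end_near. Qed.

Lemma int0pi_cell c n k : (1 <= k < n)%N ->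
  int0pi \1_(cell c n k) = pi / n%:R :> R.
Proof.
move=> kn; have /andP[k1 kn'] := kn.
have gn : grid n (grid_point c n : nat -> R).
  by apply: grid_point_grid; exact: leq_ltn_trans kn'.
have [g1 gm _] := gn.
have /andP[? ?] : 0 < (grid_point c n k : R) <= pi.
  by apply: (grid_bounds gn); rewrite k1 ltnW.
have /andP[? ?] : 0 < (grid_point c n k.+1 : R) <= pi by exact: (grid_bounds gn).
by rewrite int0pi_indic ?grid_pointS// gm.
Qed.

Lemma cell_avg_dist c n g k (r d : R) : L1_0pi g -> (1 <= k < n)%N ->
  (forall y, grid_point c n k <= y < grid_point c n k.+1 -> `|g y - r| <= d) ->
  `|cell_avg c n g k - r| <= d.
Proof.
move=> gi kn gd; have pi0 := pi_gt0 R.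
have nR : 0 < n%:R :> R by rewrite ltr0n; case/andP: kn => _; exact: leq_ltn_trans.
have ici (s : R) : L1_0pi (fun y => \1_(cell c n k) y * s).
  by apply: L1_0pi_indicM => //; exact: L1_0pi_cst.
have ici1 : L1_0pi (\1_(cell c n k) : R -> R) by exact: L1_0pi_indic.
have icgi : L1_0pi (fun y => \1_(cell c n k) y * g y) by exact: L1_0pi_indicM.
have -> : cell_avg c n g k - r =
    n%:R / pi * int0pi (fun y => \1_(cell c n k) y * g y - \1_(cell c n k) y * r).
  rewrite int0piB// int0piZr// int0pi_cell// /cell_avg mulrBr; congr (_ - _).
  by rewrite [RHS]mulrA mulrA divfK ?mulfV ?mul1r ?gt_eqF.
rewrite normrM ger0_norm ?divr_ge0 ?pi_ge0//.
rewrite -ler_pdivlMl ?divr_gt0// invf_div -(int0pi_cell c kn) -int0piZr//.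
apply: le_trans (norm_int0pi _) _; first exact: L1_0piB.
apply: norm1_le => //; first exact: L1_0piB.
move=> y _; rewrite -mulrBr normrM indic_co.
case: (boolP (_ <= y < _)) => [ky|_]; last by rewrite normr0 !mul0r.
by rewrite normr1 !mul1r gd.
Qed.

(** The cell averages of an integrable function converge to it in L1: averaging
    does not increase the norm, so it is enough to see this for the continuous
    functions, which are dense and for which the averages converge uniformly
    away from the two ends of the interval. *)
Lemma avg_cvg c f : L1_0pi f ->
  norm1 (fun x => avg c n f x - f x) @[n --> \oo] --> 0.
Proof.
move=> fi.
have : exists g_ : (R -> R)^nat, [/\ forall n, continuous (g_ n),
    forall n, L1_0pi (g_ n) & norm1 (fun x => f x - g_ n x) @[n --> \oo] --> 0].
  have fin0pi : (@lebesgue_measure R `]0%R, pi[%classic < +oo)%E.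
    by rewrite lebesgue_I0pi ltry.
  have [g_ [gc gi fg]] :=
    approximation_continuous_integrable (@measurable_I0pi R) fin0pi fi.
  by exists g_; split => //; move/fine_cvg : fg.
move=> [g_ [gc gi fg]]; apply/cvgr0Pnorm_le => e e0.
(* [d * (pi + 3)] is the total cost of going from [avg c n f] to [avg c n g],
   to [g] cut off outside the grid, to [g] and to [f]. *)
have d0 : 0 < e / (pi + 3) by rewrite divr_gt0// addr_gt0// pi_gt0.
set d := e / (pi + 3) in d0.
have /cvgr0Pnorm_le/(_ _ d0)[m _ /(_ _ (leqnn m)) fgd] := fg.
set g := g_ m in fgd; move: (gc m) (gi m); rewrite -/g => {}gc {}gi.
rewrite /= ger0_norm ?norm1_ge0// in fgd.
have /cvgr0Pnorm_le/(_ _ d0) ends :=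
  norm1_indic_cvg gi (grid_point1_cvg c) (grid_pointn_cvg c).
near=> n; rewrite ger0_norm ?norm1_ge0//.
have n0 : (0 < n)%N by near: n; exact: nbhs_infty_gt.
have gn := @grid_point_grid c n n0.
have nR : 0 < n%:R :> R by rewrite ltr0n.
have pi0 := pi_gt0 R.
have ai h : L1_0pi (avg c n h) by exact: L1_step.
set s1 := \1_(`[grid_point c n 1, grid_point c n n[%classic) : R -> R.
have si : L1_0pi (fun x => s1 x * g x).
  by apply: L1_0pi_indicM => //; exact: measurable_itv.
have h1 : norm1 (fun x => avg c n f x - avg c n g x) <= d.
  under [X in norm1 X]eq_fun do rewrite avgB//.
  by apply: le_trans fgd; apply: norm1_avg => //; exact: L1_0piB.
have h2 : norm1 (fun x => avg c n g x - s1 x * g x) <= d * pi.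
  rewrite -int0pi_cst; apply: norm1_le; [exact: L1_0piB|exact: L1_0pi_cst|].
  move=> x /andP[x0 xpi]; rewrite /s1 -step1E//.
  have [[k kn kx]|xo] := step_case x gn; last first.
    by rewrite /avg !(step_out _ xo) mul0r subrr normr0 ltW.
  rewrite /avg !(step_cell _ gn kn kx) mul1r.
  have unif : forall x y, 0 <= x <= pi -> `|x - y| <= pi / n%:R -> `|g x - g y| <= d.
    by near: n; exact: unif_cont_0pi.
  apply: cell_avg_dist => // y ky; rewrite distrC; apply: unif; first by rewrite !ltW.
  by have := grid_pointS c n k; move: kx ky; rewrite ler_norml; lra.
have h3 : norm1 (fun x => s1 x * g x - g x) <= d.
  have : `|norm1 (fun x => s1 x * g x - g x)| <= d by rewrite /s1; near: n.
  by rewrite ger0_norm ?norm1_ge0.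
have h4 : norm1 (fun x => g x - f x) <= d by rewrite norm1_sym.
have h5 := le_trans (norm1_triangle (ai g) si gi) (lerD h2 h3).
apply: le_trans (norm1_triangle (ai f) (ai g) fi) _.
apply: le_trans (lerD h1 (norm1_triangle (ai g) gi fi)) _.
apply: le_trans (lerD (lexx d) (lerD h5 h4)) _.
have -> : e = d * (pi + 3) by rewrite /d divfK// gt_eqF// addr_gt0.
have E (a b : R) : a + (a * b + a + a) = a * (b + 3) by ring.
by rewrite E.
Unshelve. all: by end_near. Qed.

End CellAverages.
#[global] Hint Resolve measurable_cell : core.

(** * The associated function vanishes *)

Section AssociatedFunction.
Context {R : realType}.
Implicit Types (X Y : nat -> nat -> R) (p q r : R -> R) (c : bcase) (n k : nat).

(** The deviation of the [k]-th grid length from the uniform mesh [pi / n], in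
    the scale where [Fdif] compares it with [p]. *)
Definition dev X n k : R := n%:R ^+ 2 * grid_length X n k - n%:R * pi.

Lemma Sigma_dif_grid X n : Sigma_dif X -> (3 <= n)%N -> grid n (X n).
Proof.
move=> [XS _] n3; have [X1 Xm Xn] := XS n n3; split => // k kn.
exact/ltW/Xm.
Qed.

Lemma FdifE X p n x : Fdif X p n x =
  2 * n%:R * (step (X n) (dev X n) n x - step (X n) (fun=> 1) n x * p x).
Proof.
rewrite /Fdif /step mulr_suml -sumrB mulr_sumr; apply: eq_bigr => k _.
by rewrite /dev; move: (pi : R) => t; ring.
Qed.

Lemma L1_Fdif X p n : L1_0pi p -> L1_0pi (Fdif X p n).
Proof.
move=> pi1; rewrite (_ : Fdif X p n = fun x => 2 * n%:R *
    (step (X n) (dev X n) n x - step (X n) (fun=> 1) n x * p x)); last first.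
  by apply/funext => x; exact: FdifE.
apply: L1_0piZ; apply: L1_0piB; first exact: L1_step.
rewrite (_ : (fun x => _) = fun x =>
    \sum_(1 <= k < n) \1_(`[X n k, X n k.+1[%classic) x * p x).
  by apply: L1_0pi_sum => k; exact: L1_0pi_indicM.
by apply/funext => x; rewrite /step mulr_suml; apply: eq_bigr => k _; rewrite mulr1.
Qed.

Lemma quasinodal_with_cvg X p q : quasinodal_with X p q ->
  norm1 (fun x => Fdif X p n x - q x) @[n --> \oo] --> 0.
Proof. by move=> [_ /fine_cvg]. Qed.

(** Telescoping: the deviation of a cell is the difference of the errors at its
    two ends. *)
Lemma dev_sum X c n i j : (0 < n)%N -> (i <= j)%N ->
  \sum_(i <= k < j) dev X n k =
  n%:R ^+ 2 * ((X n j - grid_point c n j) - (X n i - grid_point c n i)).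
Proof.
move=> n0 ij; rewrite -[RHS]mulrC.
have nR : n%:R != 0 :> R by rewrite pnatr_eq0 -lt0n.
have E k : dev X n k =
    n%:R ^+ 2 * ((X n k.+1 - grid_point c n k.+1) - (X n k - grid_point c n k)).
  have -> : (X n k.+1 - grid_point c n k.+1) - (X n k - grid_point c n k) =
      grid_length X n k - (grid_point c n k.+1 - grid_point c n k).
    by rewrite /grid_length; ring.
  by rewrite grid_pointS /dev; move: (pi : R) => t; field.
under eq_bigr do rewrite E.
by rewrite -mulr_sumr telescope_sumr// mulrC.
Qed.

Lemma dev_le X c n k (C : R) : (1 <= k < n)%N ->
  (forall k, (1 <= k <= n)%N -> `|X n k - grid_point c n k| <= C / n%:R ^+ 2) ->
  `|dev X n k| <= 2 * C.
Proof.
move=> /andP[k1 kn] XC; have n0 : (0 < n)%N by exact: leq_ltn_trans kn.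
have nR : 0 < n%:R :> R by rewrite ltr0n.
have := @dev_sum X c n k k.+1 n0 (leqnSn k); rewrite big_nat1 => ->.
rewrite normrM ger0_norm ?exprn_ge0// mulrC -ler_pdivlMr ?exprn_gt0//.
apply: le_trans (ler_normB _ _) _; rewrite -mulrA mulrDl mul1r lerD// XC//.
by rewrite k1 ltnW.
Qed.

Lemma in_case_cvg X c (l : R) (k : nat -> nat) : in_case c X ->
  (forall n, (0 < n)%N -> (1 <= k n <= n)%N) ->
  grid_point c n (k n) @[n --> \oo] --> l -> X n (k n) @[n --> \oo] --> l.
Proof.
move=> [C XC] kP gl.
have h0 : grid_point c n (k n) + `|C| / n%:R @[n --> \oo] --> l.
  by rewrite -[X in _ --> X]addr0; apply: cvgD gl _; exact: cvg_div_nat.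
have h1 : grid_point c n (k n) - `|C| / n%:R @[n --> \oo] --> l.
  by rewrite -[X in _ --> X]subr0; apply: cvgB gl _; exact: cvg_div_nat.
apply: (squeeze_cvgr _ h1 h0); near=> n.
have n0 : (0 < n)%N by near: n; exact: nbhs_infty_gt.
have : forall k, (1 <= k <= n)%N -> `|X n k - grid_point c n k| <= C / n%:R ^+ 2.
  by near: n.
move=> /(_ (k n) (kP n n0)) XC'; rewrite -ler_distl; apply: le_trans XC' _.
apply: (@le_trans _ _ (`|C| / n%:R ^+ 2)).
  by rewrite ler_wpM2r ?invr_ge0 ?exprn_ge0// ler_norm.
rewrite ler_wpM2l// lef_pV2 ?posrE ?exprn_gt0 ?ltr0n// expr2 ler_peMl//.
by rewrite ler1n.
Unshelve. all: by end_near. Qed.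

Lemma in_case_cvg1 X c : in_case c X -> X n 1%N @[n --> \oo] --> 0.
Proof.
by move=> cX; apply: (in_case_cvg (k := fun=> 1%N) cX) => //; exact: grid_point1_cvg.
Qed.

Lemma in_case_cvgn X c : in_case c X -> X n n @[n --> \oo] --> (pi : R).
Proof.
move=> cX; apply: (in_case_cvg (k := id) cX); last exact: grid_pointn_cvg.
by move=> n n0; rewrite n0 leqnn.
Qed.

(** On the cells of [X n], [Fdif] is [2 n] times the difference between the
    deviations and [p], and it stays bounded in L1, so that difference is O(1/n). Moving the heights, which are
    O(1), to the uniform grid costs [n] times O(1/n^2). *)
Lemma dev_step_cvg X p q c : Sigma_dif X -> quasinodal_with X p q -> in_case c X ->
  norm1 (fun x => step (grid_point c n) (dev X n) n x - p x) @[n --> \oo] --> 0.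
Proof.
move=> XS XpqF cX; have := quasinodal_with_cvg XpqF; have [[pW qi] _ _] := XpqF.
move=> Fq; have pL := W22_L1 pW.
have ends := norm1_indic_cvg pL (in_case_cvg1 cX) (in_case_cvgn cX).
have [C XC] := cX.
have bnd : (4 * C ^+ 2) / n%:R +
   (norm1 (fun x => Fdif X p n x - q x) + norm1 q) * (2^-1 / n%:R) +
   norm1 (fun x => \1_(`[X n 1%N, X n n[%classic) x * p x - p x)
    @[n --> \oo] --> 0.
  rewrite [X in _ --> X](_ : 0 = 0 + (0 + norm1 q) * 0 + 0); last first.
    by rewrite mulr0 !addr0.
  apply: cvgD ends; apply: cvgD; first exact: cvg_div_nat.
  apply: cvgM; last exact: cvg_div_nat.
  by apply: cvgD Fq _; exact: cvg_cst.
apply: squeeze_cvgr _ (@cvg_cst _ _ _ _ _) bnd; near=> n.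
rewrite norm1_ge0/=.
have n3 : (3 <= n)%N by near: n; exact: nbhs_infty_ge.
have n0 : (0 < n)%N by exact: leq_trans n3.
have nR : 0 < n%:R :> R by rewrite ltr0n.
have Xn : forall k, (1 <= k <= n)%N -> `|X n k - grid_point c n k| <= C / n%:R ^+ 2.
  by near: n.
have Xg := Sigma_dif_grid XS n3.
have gg := @grid_point_grid R c n n0.
have Li g a : L1_0pi (step g a n : R -> R) by exact: L1_step.
set s1 := \1_(`[X n 1%N, X n n[%classic) : R -> R.
have si : L1_0pi (fun x => s1 x * p x).
  by apply: L1_0pi_indicM => //; exact: measurable_itv.
(* From the uniform grid to the grid [X n], then to [p] cut off outside [X n],
   then to [p]: one term of the bound for each. *)
apply: le_trans (norm1_triangle (Li _ _) (Li (X n) (dev X n)) pL) _.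
rewrite -addrA lerD//.
  rewrite norm1_sym; apply: le_trans (norm1_regrid _ Xg gg Xn) _.
  have : \sum_(1 <= k < n) `|dev X n k| <= n%:R * (2 * C).
    apply: (@le_trans _ _ (\sum_(1 <= k < n) 2 * C)).
      by apply: ler_sum_nat => k kn; exact: dev_le Xn.
    rewrite sumr_const_nat -[leLHS]mulr_natl ler_wpM2r ?ler_nat ?leq_subr//.
    have := Xn 1%N; rewrite n0 => /(_ isT) /(le_trans (normr_ge0 _)).
    by rewrite pmulr_lge0 ?invr_gt0 ?exprn_gt0// => ?; rewrite mulr_ge0.
  have C0 : 0 <= 2 * (C / n%:R ^+ 2).
    have := Xn 1%N; rewrite n0 => /(_ isT) /(le_trans (normr_ge0 _)).
    by move=> ?; rewrite mulr_ge0.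
  move=> /(ler_wpM2l C0) /le_trans; apply.
  rewrite le_eqVlt; apply/orP; left; apply/eqP; field.
  by rewrite gt_eqF.
apply: le_trans (norm1_triangle (Li _ _) si pL) _; rewrite lerD//.
have FL := L1_Fdif X n pL.
apply: (@le_trans _ _ (norm1 (Fdif X p n) * (2^-1 / n%:R))).
  rewrite mulrC -[X in X * _](ger0_norm (_ : 0 <= _)); last first.
    by rewrite mulr_ge0 ?invr_ge0// ltW.
  rewrite -norm1Zl// le_eqVlt; apply/orP; left; apply/eqP.
  congr norm1; apply/funext => x; rewrite FdifE step1E// -/s1; field.
  by rewrite gt_eqF.
rewrite ler_wpM2r//.
apply: le_trans (norm1D (L1_0piB FL qi) qi).
by rewrite le_eqVlt; apply/orP; left; apply/eqP; congr norm1; apply/funext => x; rewrite subrK.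
Unshelve. all: by end_near. Qed.

Lemma indicM_step (g a : nat -> R) n i j x : grid n g -> (1 <= i)%N -> (i <= j)%N ->
  (j <= n)%N -> \1_(`[g i, g j[%classic) x * step g a n x =
  step g (fun k => if (i <= k < j)%N then a k else 0) n x.
Proof.
move=> gn i1 ij jn; have [[k kn kx]|xo] := step_case x gn; last first.
  by rewrite !(step_out _ xo) mulr0.
rewrite !(step_cell _ gn kn kx) indic_co.
have /andP[k1 kn'] := kn; have /andP[gkx xgk] := kx.
have [ik|ki] := leqP i k => /=; last first.
  have := grid_le (l := i) gn (_ : (1 <= k.+1 <= i)%N) (leq_trans ij jn).
  by move=> /(_ ki) h; rewrite leNgt (lt_le_trans xgk h)/= mul0r.
have := grid_le gn (_ : (1 <= i <= k)%N) (ltnW kn').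
rewrite i1 => /(_ ik) h; rewrite (le_trans h gkx)/=.
have [kj|jk] := ltnP k j => /=.
  have := grid_le gn (_ : (1 <= k.+1 <= j)%N) jn.
  by move=> /(_ kj) h'; rewrite (lt_le_trans xgk h') mul1r.
have := grid_le gn (_ : (1 <= j <= k)%N) (ltnW kn').
rewrite (leq_trans i1 ij) => /(_ jk) h'.
by rewrite ltNge (le_trans h' gkx)/= mul0r.
Qed.

Lemma int0pi_indicM_step c (a : nat -> R) n i j : (1 <= i)%N -> (i <= j)%N ->
  (j <= n)%N ->
  int0pi (fun x => \1_(`[grid_point c n i, grid_point c n j[%classic) x *
    step (grid_point c n) a n x) =
  pi / n%:R * \sum_(i <= k < j) a k.
Proof.
move=> i1 ij jn.
have n0 : (0 < n)%N by exact: leq_trans i1 (leq_trans ij jn).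
have gn := @grid_point_grid R c n n0.
rewrite (_ : (fun x => _) = step (grid_point c n)
    (fun k => if (i <= k < j)%N then a k else 0) n); last first.
  by apply/funext => x; exact: indicM_step.
rewrite int0pi_step// mulr_sumr.
rewrite (big_cat_nat i1 (leq_trans ij jn))/= (big_cat_nat ij jn)/=.
rewrite big_nat_cond big1 ?add0r; last first.
  by move=> k /andP[/andP[_ ki] _]; rewrite leqNgt ki mulr0.
rewrite [X in _ + X]big_nat_cond [X in _ + X]big1 ?addr0; last first.
  by move=> k /andP[/andP[jk _] _]; rewrite ltnNge jk andbF mulr0.
by apply: eq_big_nat => k kij; rewrite kij grid_pointS.
Qed.

(** The factor is odd so that the nodes of the coarse grid are nodes of the fine
    one in the first case too, where they are the odd multiples of
    [pi / (2 N)]. *)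
Lemma grid_point_refine c N i : exists2 j : nat -> nat,
  (forall k, (1 <= k)%N -> grid_point c N k = grid_point c (N * i.*2.+1)%N (j k) :> R) &
  forall k, (1 <= k < N)%N ->
    [/\ (1 <= j k)%N, (j k <= j k.+1)%N & (j k.+1 <= N * i.*2.+1)%N].
Proof.
have [m mE] : exists m, m = i.*2.+1 by exists i.*2.+1.
have m0 : (m%:R : R) != 0 by rewrite pnatr_eq0 mE.
have iE : i%:R = (m%:R - 1) / 2 :> R.
  by rewrite mE -addn1 natrD -muln2 natrM addrK mulfK// pnatr_eq0.
rewrite -mE; exists (fun k => k * m - (if c is CaseI then i else 0))%N => k.
  move=> k1; have [->|N0] := eqVneq N 0%N.
    by rewrite mul0n; case: c; rewrite /grid_point invr0 !mulr0.
  have NR : (N%:R : R) != 0 by rewrite pnatr_eq0.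
  have ik : (i <= k * m)%N.
    by apply: leq_trans (leq_pmull m k1); rewrite mE -addnn; lia.
  case: c; rewrite /grid_point ?subn0 ?natrB// !natrM ?iE;
    by move: (pi : R) => t; field; rewrite NR m0.
have mi : (i < m)%N by rewrite mE -addnn; lia.
move=> /andP[k1 kN]; have h1 : (m <= k * m)%N by rewrite leq_pmull.
have h2 : (k.+1 * m <= N * m)%N by rewrite leq_mul2r kN orbT.
have h3 : (k * m <= k.+1 * m)%N by rewrite leq_mul2r leqnSn orbT.
by case: c; split; lia.
Qed.

(** The nodes of [X] are within O(1/n^2) of the uniform ones, so the deviations
    of the grid lengths add up to O(1) over any block of cells: their means over
    a fixed interval are O(1/n), and [p], their limit in L1, has mean 0 on it. *)
Lemma int_cell_assoc_p X p q c N k : Sigma_dif X -> quasinodal_with X p q ->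
  in_case c X -> (1 <= k < N)%N -> int0pi (fun x => \1_(cell c N k) x * p x) = 0.
Proof.
move=> XS Xpq cX kN; have := dev_step_cvg XS Xpq cX; have [[/W22_L1 pL _] _ _] := Xpq.
move=> devp; apply/eqP; rewrite -normr_le0; apply/ler_addgt0Pr => e e0; rewrite add0r.
have [C XC] := cX.
have : \forall n \near \oo, `|norm1 (fun x => step (grid_point c n) (dev X n) n x - p x) +
    2 * C * pi / n%:R| <= e.
  move: e e0; apply/cvgr0Pnorm_le; rewrite -[X in _ --> X]addr0.
  by apply: cvgD; [exact: devp|exact: cvg_div_nat].
move=> near1; have [M _ MP] := filterI near1 XC.
have [n nE] : exists n, n = (N * M.*2.+1)%N by exists (N * M.*2.+1)%N.
have N0 : (0 < N)%N by case/andP: kN => _; exact: leq_ltn_trans.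
have n0 : (0 < n)%N by rewrite nE muln_gt0 N0.
have Mn : (M <= n)%N.
  by rewrite nE (leq_trans _ (leq_pmull _ N0))// -addnn; lia.
have [ /(le_trans (ler_norm _)) h Xn] := MP n Mn.
apply: le_trans h.
have nR : 0 < n%:R :> R by rewrite ltr0n.
have [j jE jP] := grid_point_refine c N M; rewrite -nE in jE jP.
have [j1 jj jn] := jP k kN.
have /andP[k1 _] := kN.
set s := step (grid_point c n) (dev X n) n.
have sL : L1_0pi s by exact: L1_step.
have -> : int0pi (fun x => \1_(cell c N k) x * p x) =
    int0pi (fun x => \1_(cell c N k) x * s x) -
    int0pi (fun x => \1_(cell c N k) x * (s x - p x)).
  rewrite -int0piB; [|by apply: L1_0pi_indicM => //; exact: L1_0piB..].
  by apply: eq_int0pi => x _; ring.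
apply: le_trans (ler_normB _ _) _; rewrite addrC lerD//.
  apply: le_trans (norm_int0pi _) _; first by apply: L1_0pi_indicM => //; exact: L1_0piB.
  apply: norm1_le; [by apply: L1_0pi_indicM => //; exact: L1_0piB| |].
    by apply: L1_0pi_abs; exact: L1_0piB.
  move=> x _; rewrite normrM ler_piMl// indicE.
  by case: (_ \in _); rewrite ?normr1 ?normr0.
rewrite /cell !jE// int0pi_indicM_step// (dev_sum X c n0 jj).
rewrite [X in `|X|](_ : _ = pi * n%:R * ((X n (j k.+1) - grid_point c n (j k.+1)) -
    (X n (j k) - grid_point c n (j k)))); last first.
  by move: (pi : R) => t; field; rewrite gt_eqF.
rewrite normrM ger0_norm ?mulr_ge0 ?pi_ge0//.
have jk : (1 <= j k <= n)%N by rewrite j1 (leq_trans jj).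
have jk1 : (1 <= j k.+1 <= n)%N by rewrite jn (leq_trans j1).
have := le_trans (ler_normB _ _) (lerD (Xn _ jk1) (Xn _ jk)).
have pn0 : 0 <= pi * n%:R :> R by rewrite mulr_ge0 ?pi_ge0.
move=> /(ler_wpM2l pn0) /le_trans; apply.
rewrite le_eqVlt; apply/orP; left; apply/eqP; move: (pi : R) => t; field.
by rewrite gt_eqF.
Qed.

Lemma norm1_assoc0 X p q : Sigma_dif X -> quasinodal_with X p q -> norm1 p = 0.
Proof.
move=> XS Xpq; have [[/W22_L1 pL _] _ [c cX]] := Xpq.
have := avg_cvg c pL.
have -> : (fun n => norm1 (fun x => avg c n p x - p x)) = cst (norm1 p).
  apply/funext => n; rewrite /= -int0pi_abs; apply: eq_int0pi => x _.
  rewrite (_ : avg c n p x = 0) ?sub0r ?normrN//.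
  rewrite /avg /step big_nat_cond big1// => k /andP[kn _].
  by rewrite /cell_avg (int_cell_assoc_p XS Xpq cX kn) !mulr0.
by move=> h; apply: (cvg_unique _ _ h) => //; exact: cvg_cst.
Qed.

End AssociatedFunction.

(** * The distance between two quasinodal sequences *)

Section Distance.
Context {R : realType}.
Implicit Types (X Y : nat -> nat -> R) (p q r : R -> R) (c : bcase) (n k : nat).

(** The values of [Fdif X 0 n] on the cells of [X n]. *)
Definition nodal_coef X n k : R := 2 * n%:R * dev X n k.

Lemma nodal_step_cvg X p q : Sigma_dif X -> quasinodal_with X p q ->
  norm1 (fun x => step (X n) (nodal_coef X n) n x - q x) @[n --> \oo] --> 0.
Proof.
move=> XS Xpq; have [[/W22_L1 pL qL] _ _] := Xpq.
apply: squeeze_cvgr _ (@cvg_cst _ _ _ _ _) (quasinodal_with_cvg Xpq).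
near=> n; rewrite norm1_ge0/=.
have n3 : (3 <= n)%N by near: n; exact: nbhs_infty_ge.
have Xg := Sigma_dif_grid XS n3.
have FL := L1_Fdif X n pL.
have sL : L1_0pi (step (X n) (nodal_coef X n) n : R -> R) by exact: L1_step.
have pZ : L1_0pi (fun x => 2 * n%:R * p x) by exact: L1_0piZ.
apply: le_trans (norm1_triangle sL FL qL) _; rewrite gerDr.
apply: (@le_trans _ _ (norm1 (fun x => 2 * n%:R * p x))); last first.
  by rewrite norm1Zl// (norm1_assoc0 XS Xpq) mulr0.
rewrite -[leRHS]int0pi_abs; apply: norm1_le; [exact: L1_0piB|exact: L1_0pi_abs|].
move=> x _; rewrite FdifE stepZ -mulrBr subKr [leRHS]normrM normrM ler_wpM2l//.
have /andP[s0 s1] := step_le1 x Xg.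
by rewrite normrM ler_piMl// ger0_norm.
Unshelve. all: by end_near. Qed.

(** Every node moves by O(1/n^2), and the heights have an absolute sum O(n): their
    step function on [X n] is bounded in L1 and its cells, for large [n], are no
    shorter than half of [pi / n]. *)
Lemma uniform_step_cvg X p q c : Sigma_dif X -> quasinodal_with X p q ->
  in_case c X ->
  norm1 (fun x => step (grid_point c n) (nodal_coef X n) n x - q x)
    @[n --> \oo] --> 0.
Proof.
move=> XS Xpq [C XC]; have sq := nodal_step_cvg XS Xpq.
have [[/W22_L1 pL qL] _ _] := Xpq.
have pi0 := pi_gt0 R.
have bnd : (4 * C / pi) / n%:R *
    (norm1 (fun x => step (X n) (nodal_coef X n) n x - q x) + norm1 q) +
    norm1 (fun x => step (X n) (nodal_coef X n) n x - q x) @[n --> \oo] --> 0.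
  rewrite [X in _ --> X](_ : 0 = 0 * (0 + norm1 q) + 0); last first.
    by rewrite mul0r addr0.
  apply: (cvgD _ sq); apply: cvgM; first exact: cvg_div_nat.
  by apply: (cvgD sq _); exact: cvg_cst.
apply: squeeze_cvgr _ (@cvg_cst _ _ _ _ _) bnd; near=> n.
rewrite norm1_ge0/=.
have n3 : (3 <= n)%N by near: n; exact: nbhs_infty_ge.
have n0 : (0 < n)%N by exact: leq_trans n3.
have nR : 0 < n%:R :> R by rewrite ltr0n.
have Xn : forall k, (1 <= k <= n)%N -> `|X n k - grid_point c n k| <= C / n%:R ^+ 2.
  by near: n.
have Xg := Sigma_dif_grid XS n3.
have gg := @grid_point_grid R c n n0.
have C0 : 0 <= C.
  have := Xn 1%N; rewrite n0 => /(_ isT) /(le_trans (normr_ge0 _)).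
  by rewrite pmulr_lge0 ?invr_gt0 ?exprn_gt0.
have Li g a : L1_0pi (step g a n : R -> R) by exact: L1_step.
apply: le_trans (norm1_triangle (Li _ _) (Li (X n) (nodal_coef X n)) qL) _.
rewrite lerD// norm1_sym; apply: le_trans (norm1_regrid _ Xg gg Xn) _.
have short k : (1 <= k < n)%N -> pi / (2 * n%:R) <= X n k.+1 - X n k.
  have : 4 * C / pi < n%:R by near: n; exact: nbhs_infty_gtr.
  rewrite ltr_pdivrMr// => Cn kn; have := dev_le kn Xn.
  rewrite ler_norml /dev /grid_length => /andP[+ _].
  rewrite -[X in _ -> _ <= X](mulfK (lt0r_neq0 (_ : 0 < n%:R ^+ 2))) ?exprn_gt0//.
  rewrite ler_pdivlMr ?exprn_gt0// (mulrC (X n k.+1 - X n k)).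
  rewrite (_ : pi / (2 * n%:R) * n%:R ^+ 2 = n%:R * pi / 2); last first.
    by move: (pi : R) => t; field; rewrite gt_eqF.
  move: (pi : R) Cn (n%:R ^+ 2 * _) => t Cn u; lra.
have sumle : \sum_(1 <= k < n) `|nodal_coef X n k| <=
    2 * n%:R / pi * (norm1 (fun x => step (X n) (nodal_coef X n) n x - q x) + norm1 q).
  rewrite -ler_pdivrMl ?divr_gt0 ?mulr_gt0// invf_div.
  apply: (@le_trans _ _ (norm1 (step (X n) (nodal_coef X n) n))).
    rewrite norm1_step// mulr_sumr; apply: ler_sum_nat => k kn.
    by rewrite ler_wpM2r// short.
  apply: le_trans (norm1D (L1_0piB (Li _ _) qL) qL).
  by rewrite le_eqVlt; apply/orP; left; apply/eqP; congr norm1; apply/funext => x; rewrite subrK.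
have C2 : 0 <= 2 * (C / n%:R ^+ 2) by rewrite mulr_ge0// divr_ge0// exprn_ge0.
apply: le_trans (ler_wpM2l C2 sumle) _.
rewrite le_eqVlt; apply/orP; left; apply/eqP.
move: (norm1 _ + norm1 q) (pi : R) pi0 => w t t0; field.
by rewrite !gt_eqF.
Unshelve. all: by end_near. Qed.

Lemma norm1B_cvg (u v : nat -> R -> R) q r :
  (forall n, L1_0pi (u n)) -> (forall n, L1_0pi (v n)) -> L1_0pi q -> L1_0pi r ->
  norm1 (fun x => u n x - q x) @[n --> \oo] --> 0 ->
  norm1 (fun x => v n x - r x) @[n --> \oo] --> 0 ->
  norm1 (fun x => u n x - v n x) @[n --> \oo] --> norm1 (fun x => q x - r x).
Proof.
move=> uL vL qL rL uq vr; apply/cvgrPdist_le => e e0.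
have uqvr : norm1 (fun x => u n x - q x) + norm1 (fun x => v n x - r x)
    @[n --> \oo] --> 0.
  by rewrite -[X in _ --> X]addr0; exact: cvgD.
have /cvgr0Pnorm_le/(_ _ e0) := uqvr.
apply: filterS => n /(le_trans (ler_norm _)); apply: le_trans.
have h1 := le_trans (norm1_triangle (uL n) qL (vL n))
  (lerD (lexx _) (norm1_triangle qL rL (vL n))).
have h2 := le_trans (norm1_triangle qL (uL n) rL)
  (lerD (lexx _) (norm1_triangle (uL n) (vL n) rL)).
rewrite (norm1_sym r) in h1; rewrite (norm1_sym q (u n)) in h2.
move: h1 h2; rewrite ler_norml.
move: (norm1 _) (norm1 _) (norm1 _) (norm1 _) => A B D E h1 h2.
by apply/andP; split; lra.
Qed.

(** The choice made in [assoc_p] is harmless, every candidate being null. *)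
Lemma norm1_assoc_p X : Sigma_dif1 X -> norm1 (assoc_p X) = 0.
Proof.
move=> [XS [q _ [p Xpq]]]; rewrite /assoc_p; case: xgetP => [p' _ [q' Xpq']|].
  exact: norm1_assoc0 Xpq'.
by move=> /(_ p)[]; exists q.
Qed.

(** All cells of the uniform grid have length [pi / n], which turns the L1 norm
    into a sum of differences of grid lengths. *)
Lemma S_difE X Y c n : Sigma_dif1 X -> Sigma_dif1 Y -> (0 < n)%N ->
  S_dif X Y n = norm1 (fun x => step (grid_point c n) (nodal_coef X n) n x -
    step (grid_point c n) (nodal_coef Y n) n x) / 2.
Proof.
move=> X1 Y1 n0; have nR : 0 < n%:R :> R by rewrite ltr0n.
have pX := assoc_p_L1 X1; have pY := assoc_p_L1 Y1.
rewrite /S_dif -/(norm1 _) (_ : norm1 _ = 0) ?mulr0 ?addr0; last first.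
  apply/eqP; rewrite eq_le norm1_ge0 andbT.
  have pYN : L1_0pi (fun x => - 1 * assoc_p Y x) by exact: L1_0piZ.
  have := norm1D pX pYN; rewrite norm1Zl// !norm1_assoc_p// mulr0 addr0.
  by apply: le_trans; rewrite le_eqVlt; apply/orP; left; apply/eqP;
    congr norm1; apply/funext => x; rewrite mulN1r.
rewrite [X in norm1 X](_ : _ = step (grid_point c n)
    (fun k => nodal_coef X n k - nodal_coef Y n k) n); last first.
  by apply/funext => x; rewrite stepB.
rewrite norm1_uniform_step//.
under [in RHS]eq_bigr => k _.
  rewrite (_ : nodal_coef X n k - nodal_coef Y n k =
      2 * n%:R ^+ 3 * (grid_length X n k - grid_length Y n k)).
    rewrite normrM ger0_norm; last by rewrite mulr_ge0// exprn_ge0// ltW.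
    over.
  by rewrite /nodal_coef /dev; move: (pi : R) => t; ring.
rewrite -mulr_sumr; move: (\sum_(_ <= _ < _) _) (pi : R) => t u; field.
by rewrite gt_eqF.
Qed.

Lemma S_dif_cvg X Y q r c : Sigma_dif1 X -> Sigma_dif1 Y ->
  quasinodal X q -> quasinodal Y r -> in_case c X -> in_case c Y ->
  S_dif X Y n @[n --> \oo] --> norm1 (fun x => q x - r x) / 2.
Proof.
move=> X1 Y1 [p Xpq] [p' Ypr] cX cY.
have [[_ qL] _ _] := Xpq; have [[_ rL] _ _] := Ypr.
have XS := proj1 X1; have YS := proj1 Y1.
have := norm1B_cvg _ _ qL rL (uniform_step_cvg XS Xpq cX) (uniform_step_cvg YS Ypr cY).
move=> /(_ (fun n => L1_step _ _ _)) /(_ (fun n => L1_step _ _ _)) h.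
have h2 : norm1 (fun x => step (grid_point c n) (nodal_coef X n) n x -
    step (grid_point c n) (nodal_coef Y n) n x) / 2 @[n --> \oo] -->
    norm1 (fun x => q x - r x) / 2.
  by apply: cvgM => //; exact: cvg_cst.
apply: cvg_trans h2; apply: near_eq_cvg; near=> n.
have n0 : (0 < n)%N by near: n; exact: nbhs_infty_gt.
by rewrite (S_difE c X1 Y1 n0).
Unshelve. all: by end_near. Qed.

Lemma d_SigmaE X Y q r c : Sigma_dif1 X -> Sigma_dif1 Y ->
  quasinodal X q -> quasinodal Y r -> in_case c X -> in_case c Y ->
  d_Sigma X Y = norm1 (fun x => q x - r x) / (2 + norm1 (fun x => q x - r x)).
Proof.
move=> X1 Y1 Xq Yr cX cY; rewrite d_Sigma_same; last by exists c.
have SN := S_dif_cvg X1 Y1 Xq Yr cX cY.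
set N := norm1 _ in SN *.
have N0 : 0 <= N by exact: norm1_ge0.
have -> : N / (2 + N) = N / 2 / (1 + N / 2) by field; rewrite !gt_eqF//; lra.
apply: (cvg_limn_inf_sup _).2; apply: cvgM => //.
apply: cvgV; first by rewrite gt_eqF//; lra.
by apply: cvgD => //; exact: cvg_cst.
Qed.

End Distance.

(** * A quasinodal sequence for every integrable function *)

Section Existence.
Context {R : realType}.
Implicit Types (X : nat -> nat -> R) (q : R -> R) (c : bcase) (n k : nat).

Lemma W22_0 : @W22_0pi R (fun=> 0).
Proof.
have ac0 : abs_continuous 0 pi (fun=> 0 : R).
  by move=> e e0; exists 1 => // n x y _ _ _; rewrite big1// => i _; rewrite subrr normr0.
split=> //; exists (fun=> 0), (fun=> 0); split=> //.
- by move=> x _; exact: is_derive_cst.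
- by apply: aeW => x _; exact: is_derive_cst.
- split; first exact: measurable_cst.
  have := @L1_0pi_cst R 0; congr (_.-integrable _ _); apply/funext => x /=.
  by rewrite expr0n.
Qed.

(** Over [n^2], a bound for the total of the lengths added to the cells. *)
Definition nodal_margin q : R := norm1 q / (2 * pi).

(** Displacement of the [k]-th node. Lengthening the [j]-th cell by [1 / (2 n^3)]
    times the average of [q] on it makes [Fdif] with [p = 0] equal to that average
    on the cell. Moving the whole grid to the left by the most that the added
    lengths can amount to keeps the last node in the interval; for the finitely
    many [n] where the first node could become negative, or a shortened cell
    could vanish, the uniform grid is kept. *)
Definition nodal_shift c q n k : R :=
  if 2 * nodal_margin q < n%:R * pi then
    (\sum_(1 <= j < k) cell_avg c n q j) / (2 * n%:R ^+ 3) -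
    nodal_margin q / n%:R ^+ 2
  else 0.

Definition nodal_seq c q n k : R :=
  if [&& (3 <= n)%N, (1 <= k)%N & (k <= n)%N]
  then grid_point c n k + nodal_shift c q n k else 0.

Lemma nodal_margin_ge0 q : 0 <= nodal_margin q.
Proof. by rewrite divr_ge0 ?norm1_ge0// mulr_ge0 ?pi_ge0. Qed.

Lemma sum_cell_avg_margin c q n : (0 < n)%N -> L1_0pi q ->
  \sum_(1 <= j < n) `|cell_avg c n q j| <= 2 * nodal_margin q * n%:R.
Proof.
move=> n0 qL; have pi0 := pi_gt0 R; have nR : 0 < n%:R :> R by rewrite ltr0n.
have := sum_cell_avg c n0 qL; rewrite -ler_pdivlMl ?divr_gt0// => /le_trans; apply.
rewrite le_eqVlt; apply/orP; left; apply/eqP; rewrite /nodal_margin.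
by move: (pi : R) pi0 (norm1 q) => t t0 u; field; rewrite !gt_eqF.
Qed.

Lemma norm_partial_sum_cell_avg c q n k : (0 < n)%N -> (1 <= k <= n)%N -> L1_0pi q ->
  `|(\sum_(1 <= j < k) cell_avg c n q j) / (2 * n%:R ^+ 3)| <=
  nodal_margin q / n%:R ^+ 2.
Proof.
move=> n0 /andP[k1 kn] qL; have nR : 0 < n%:R :> R by rewrite ltr0n.
have n3 : 0 < 2 * n%:R ^+ 3 :> R by rewrite mulr_gt0 ?exprn_gt0.
rewrite normrM (gtr0_norm (_ : 0 < (2 * n%:R ^+ 3)^-1)) ?invr_gt0//.
rewrite ler_pdivrMr//; apply: le_trans (ler_norm_sum _ _ _) _.
apply: (@le_trans _ _ (2 * nodal_margin q * n%:R)); last first.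
  rewrite le_eqVlt; apply/orP; left; apply/eqP.
  by move: (nodal_margin q) => t; field; rewrite gt_eqF.
apply: le_trans (sum_cell_avg_margin c n0 qL).
by rewrite (big_cat_nat k1 kn)/= lerDl sumr_ge0.
Qed.

Lemma norm_nodal_shift c q n k : (0 < n)%N -> (1 <= k <= n)%N -> L1_0pi q ->
  `|nodal_shift c q n k| <= 2 * nodal_margin q / n%:R ^+ 2.
Proof.
move=> n0 kn qL; have m0 := nodal_margin_ge0 q; rewrite /nodal_shift.
have mn0 : 0 <= nodal_margin q / n%:R ^+ 2 by rewrite divr_ge0// exprn_ge0.
case: ifP => _; last by rewrite normr0 -mulrA mulr_ge0.
apply: le_trans (ler_normB _ _) _; rewrite -[leRHS]mulrA [leRHS]mulrDl mul1r lerD//.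
  exact: norm_partial_sum_cell_avg.
by rewrite ger0_norm.
Qed.

Lemma Sigma_dif_nodal_seq c q : L1_0pi q -> Sigma_dif (nodal_seq c q).
Proof.
move=> qL; have pi0 := pi_gt0 R; split; last first.
  by move=> n k nk; rewrite /nodal_seq (negbTE nk).
move=> n n3; have n0 : (0 < n)%N by exact: leq_trans n3.
have nR : 0 < n%:R :> R by rewrite ltr0n.
have m0 := nodal_margin_ge0 q.
have [g1 _ gn] := @grid_point_grid R c n n0.
rewrite /nodal_seq n3 n0 leqnn/=; split.
- rewrite /nodal_shift; case: ifPn => [small|_]; last by rewrite addr0.
  rewrite big_geq// mul0r sub0r subr_gt0.
  apply: lt_le_trans (grid_point_ge c n0 (leqnn 1)).
  rewrite ltr_pdivrMr ?exprn_gt0// expr2 mulrA divfK ?gt_eqF//.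
  by move: (pi : R) small => t; lra.
- move=> k kn; have /andP[k1 kn'] := kn; rewrite k1 (ltnW kn') kn'/=.
  rewrite /nodal_shift; case: ifPn => [small|_]; last first.
    by rewrite !addr0 -subr_gt0 grid_pointS divr_gt0.
  rewrite -subr_gt0 big_nat_recr//=.
  set S := \sum_(_ <= _ < _) _; set a := cell_avg _ _ _ _.
  rewrite (_ : _ - _ = (grid_point c n k.+1 - grid_point c n k) + a / (2 * n%:R ^+ 3));
    last by rewrite mulrDl; ring.
  rewrite grid_pointS.
  have : `|a| <= 2 * nodal_margin q * n%:R.
    apply: le_trans (sum_cell_avg_margin c n0 qL).
    rewrite (bigD1_seq k) ?iota_uniq ?mem_index_iota//= lerDl sumr_ge0//.
  rewrite ler_norml => /andP[la _].
  rewrite (_ : pi / n%:R + a / (2 * n%:R ^+ 3) =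
      (2 * n%:R * (n%:R * pi) + a) / (2 * n%:R ^+ 3)); last first.
    by move: (pi : R) (a) => t u; field; rewrite gt_eqF.
  rewrite divr_gt0 ?mulr_gt0 ?exprn_gt0//.
  have := ler_wpM2r (ltW nR) (ltW small).
  have : 0 < n%:R * (n%:R * pi) :> R by rewrite !mulr_gt0.
  move: (n%:R * pi) => t; lra.
- rewrite leqnn /nodal_shift; case: ifPn => [small|_]; last by rewrite addr0.
  have nn : (1 <= n <= n)%N by rewrite n0 leqnn.
  have := norm_partial_sum_cell_avg c n0 nn qL; rewrite ler_norml => /andP[_ h].
  by rewrite -[leRHS]addr0 lerD// subr_le0.
Qed.

Lemma in_case_nodal_seq c q : L1_0pi q -> in_case c (nodal_seq c q).
Proof.
move=> qL; exists (2 * nodal_margin q); near=> n => k kn.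
have n3 : (3 <= n)%N by near: n; exact: nbhs_infty_ge.
rewrite /nodal_seq n3 kn addrC addKr norm_nodal_shift//.
exact: leq_trans n3.
Unshelve. all: by end_near. Qed.

Lemma nodal_coef_seq c q n k : (3 <= n)%N -> 2 * nodal_margin q < n%:R * pi ->
  (1 <= k < n)%N -> nodal_coef (nodal_seq c q) n k = cell_avg c n q k.
Proof.
move=> n3 small /andP[k1 kn].
have nR : 0 < n%:R :> R by rewrite ltr0n; exact: leq_trans n3.
rewrite /nodal_coef /dev /grid_length /nodal_seq n3 k1 kn (ltnW kn)/=.
rewrite /nodal_shift small big_nat_recr//=.
set S := \sum_(_ <= _ < _) _; set a := cell_avg _ _ _ _; set m := nodal_margin q.
rewrite (_ : grid_point c n k.+1 = grid_point c n k + pi / n%:R); last first.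
  by rewrite -(grid_pointS c n k) addrC subrK.
move: (pi : R) (grid_point c n k) (S) (a) (m) => t u S' a' m'; field.
by rewrite gt_eqF.
Qed.

Lemma quasinodal_nodal_seq c q : L1_0pi q ->
  quasinodal_with (nodal_seq c q) (fun=> 0) q.
Proof.
move=> qL; have XS := Sigma_dif_nodal_seq c qL; have cX := in_case_nodal_seq c qL.
split; [by split; [exact: W22_0|]| |by exists c].
have p0 : L1_0pi (fun=> 0 : R) by exact: L1_0pi_cst.
have -> : (fun n => \int[@lebesgue_measure R]_(x in `]0%R, pi[%classic)
      `|Fdif (nodal_seq c q) (fun=> 0%R) n x - q x|%:E)%E =
    EFin \o (fun n => norm1 (fun x => Fdif (nodal_seq c q) (fun=> 0%R) n x - q x)).
  by apply/funext => n; rewrite integral_abs_norm1//; apply: L1_0piB => //; exact: L1_Fdif.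
apply: cvg_EFin; first by apply: nearW.
set m := nodal_margin q; have m0 : 0 <= m := nodal_margin_ge0 q.
have bnd : (8 * m ^+ 2) / n%:R + norm1 (fun x => avg c n q x - q x) @[n --> \oo] --> 0.
  rewrite -[X in _ --> X]addr0; apply: cvgD; first exact: cvg_div_nat.
  exact: avg_cvg.
apply: squeeze_cvgr _ (@cvg_cst _ _ _ _ _) bnd; near=> n.
rewrite norm1_ge0/=.
have n3 : (3 <= n)%N by near: n; exact: nbhs_infty_ge.
have n0 : (0 < n)%N by exact: leq_trans n3.
have nR : 0 < n%:R :> R by rewrite ltr0n.
have small : 2 * nodal_margin q < n%:R * pi.
  rewrite -ltr_pdivrMr ?pi_gt0//; near: n; exact: nbhs_infty_gtr.
have -> : Fdif (nodal_seq c q) (fun=> 0) n = step (nodal_seq c q n) (cell_avg c n q) n.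
  apply/funext => x; rewrite FdifE mulr0 subr0 -stepZ; apply: eq_big_nat => k kn.
  by congr (_ * _); rewrite -(nodal_coef_seq c n3 small kn).
have Li g a : L1_0pi (step g a n : R -> R) by exact: L1_step.
apply: le_trans (norm1_triangle (Li _ _) (Li (grid_point c n) (cell_avg c n q)) qL) _.
rewrite lerD2r; have Xg := Sigma_dif_grid XS n3; have gg := @grid_point_grid R c n n0.
have Xn k : (1 <= k <= n)%N ->
    `|nodal_seq c q n k - grid_point c n k| <= 2 * m / n%:R ^+ 2.
  by move=> kn; rewrite /nodal_seq n3 kn addrC addKr norm_nodal_shift.
apply: le_trans (norm1_regrid _ Xg gg Xn) _.
have C0 : 0 <= 2 * (2 * m / n%:R ^+ 2).
  apply: mulr_ge0 => //; apply: divr_ge0; [exact: mulr_ge0|exact: exprn_ge0].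
apply: le_trans (ler_wpM2l C0 (sum_cell_avg_margin c n0 qL)) _.
rewrite -/m le_eqVlt; apply/orP; left; apply/eqP; move: (m) => t; field.
by rewrite gt_eqF.
Unshelve. all: by end_near. Qed.

End Existence.

(** * The homeomorphism *)

Section Homeomorphism.
Context {R : realType}.

(** The function [t |-> t / (2 + t)] and its inverse tend to 0 at 0: it is smaller
    than [e] for [t < 2 e], and [t < e] when it is smaller than [e / (2 + e)]. *)
Lemma homeomorphic_dist (T U : metricType R) (A : set U) (f : T -> A) (g : A -> T) :
  cancel f g -> cancel g f ->
  (forall x y, mdist (\val (f x)) (\val (f y)) = mdist x y / (2 + mdist x y)) ->
  homeomorphic T A.
Proof.
move=> fK gK fd; exists f, g; split=> //.
- apply: continuous_comp_initial => x; apply/cvg_ballP => e e0.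
  near=> y; rewrite ballEmdist/= fd.
  have : ball x (2 * e) y by near: y; apply: nbhsx_ballx; rewrite mulr_gt0.
  rewrite ballEmdist/=; have := mdist_ge0 x y; move: (mdist x y) => t t0 te.
  by rewrite ltr_pdivrMr; nra.
- move=> a V /nbhs_ballP[e /= e0 eV].
  have d0 : 0 < e / (2 + e) by rewrite divr_gt0 ?addr_gt0.
  have : nbhs a (set_val @^-1` ball (set_val a) (e / (2 + e))).
    by apply: initial_continuous; exact: nbhsx_ballx.
  apply: (@filterS _ _ (nbhs_filter a)) => b /= ab; apply: eV; move: ab.
  rewrite !ballEmdist/=.
  have := fd (g a) (g b); rewrite !gK => ->.
  have := mdist_ge0 (g a) (g b); move: (mdist (g a) (g b)) => t t0.
  rewrite ltr_pdivrMr; last by rewrite ltr_wpDr.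
  rewrite mulrAC ltr_pdivlMr ?addr_gt0// => h; nra.
Unshelve. all: by end_near. Qed.

Local Notation Omega := (@Omega_dif R).
Local Notation Sigma1 := (@Sigma_dif1 R).

Lemma Sigma_dif1_nodal_seq (c : bcase) (q : Omega) :
  nodal_seq c (\val q) \in Sigma1.
Proof.
have qO := set_valP q; have qL := Omega_dif_L1 qO.
apply/mem_set; split; first exact: Sigma_dif_nodal_seq.
by exists (\val q) => //; exists (fun=> 0); exact: quasinodal_nodal_seq.
Qed.

Definition nodal_class (c : bcase) (q : Omega) : Sigma1 :=
  SigSub (Sigma_dif1_nodal_seq c q).

Lemma part_nodal_class (c : bcase) (q : Omega_space R) :
  (\pi_(metric_quotient (@Sigma_pseudodist R)) (nodal_class c (repr q)))%qT
    \in @Sigma_part R c.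
Proof.
apply/mem_set; exists (nodal_class c (repr q)) => //=.
exact/in_case_nodal_seq/Omega_dif_L1/set_valP.
Qed.

Definition to_Sigma_part (c : bcase) (q : Omega_space R) : Sigma_part c :=
  SigSub (part_nodal_class c q).

Lemma potential_exists (c : bcase) (a : @Sigma_part R c) :
  exists q : Omega, exists2 X : Sigma1,
    (\pi_(metric_quotient (@Sigma_pseudodist R)) X)%qT = \val a &
    in_case c (\val X) /\ quasinodal (\val X) (\val q).
Proof.
have [X cX Xa] := set_valP a.
have [_ [q qO Xq]] := set_valP X.
by exists (SigSub (mem_set qO)); exists X.
Qed.

Definition to_Omega (c : bcase) (a : Sigma_part c) : Omega_space R :=
  (\pi_(metric_quotient (@Omega_pseudodist R)) (projT1 (cid (potential_exists a))))%qT.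

Lemma Omega_homeomorphic (c : bcase) : homeomorphic (Omega_space R) (@Sigma_part R c).
Proof.
have E (X Y : Sigma1) (q r : Omega) : in_case c (\val X) -> in_case c (\val Y) ->
    quasinodal (\val X) (\val q) -> quasinodal (\val Y) (\val r) ->
    pdist (@Sigma_pseudodist R) X Y =
    pdist (@Omega_pseudodist R) q r / (2 + pdist (@Omega_pseudodist R) q r).
  by move=> cX cY Xq Yr; apply: (d_SigmaE _ _ Xq Yr cX cY); exact: set_valP.
have qnS (q : Omega) : quasinodal (\val (nodal_class c q)) (\val q).
  by exists (fun=> 0); apply/quasinodal_nodal_seq/Omega_dif_L1/set_valP.
have cS (q : Omega) : in_case c (\val (nodal_class c q)).
  exact/in_case_nodal_seq/Omega_dif_L1/set_valP.
have d0 (t : R) : 0 <= t -> t / (2 + t) = 0 -> t = 0.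
  move=> t0 /eqP; rewrite mulf_eq0 invr_eq0 => /orP[/eqP//|/eqP]; lra.
apply: (@homeomorphic_dist _ _ _ (to_Sigma_part c) (@to_Omega c)).
- move=> q; rewrite /to_Omega; case: cid => r [X /= XE [cX Xr]].
  apply: mdist_positivity; rewrite -[q]reprK.
  rewrite [mdist _ _]qdist_piE; apply: d0; first exact: pdist_ge0.
  rewrite -(E X (nodal_class c (repr q)) _ _ cX (cS _) Xr (qnS _)).
  by rewrite -qdist_piE XE qdistxx.
- move=> a; apply: val_inj => /=; rewrite /to_Omega.
  case: cid => r [X /= XE [cX Xr]]; rewrite -XE.
  apply: mdist_positivity; rewrite [mdist _ _]qdist_piE.
  rewrite (E _ _ _ _ (cS _) cX (qnS _) Xr).
  rewrite -qdist_piE reprK qdistxx mul0r//.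
- move=> q r /=; rewrite [mdist _ _]qdist_piE (E _ _ _ _ (cS _) (cS _) (qnS _) (qnS _)).
  by [].
Qed.

End Homeomorphism.

Theorem theorem4p1 (R : realType) :
  (forall c : bcase, homeomorphic (Omega_space R) (@Sigma_part R c)) /\
  (forall (X Y : nat -> nat -> R) (q r : R -> R),
     Sigma_dif1 X -> Sigma_dif1 Y ->
     Omega_dif q -> Omega_dif r ->
     quasinodal X q -> quasinodal Y r ->
     d_Sigma X Y < 1 ->
     norm1 (fun x => q x - r x) = 2 * d_Sigma X Y / (1 - d_Sigma X Y)).
Proof.
split; first exact: Omega_homeomorphic.
move=> X Y q r X1 Y1 _ _ Xq Yr dlt.
have [[c [cX cY]]|XY] := pselect (same_case X Y); last first.
  by move: dlt; rewrite d_Sigma_diff// ltxx.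
rewrite (d_SigmaE X1 Y1 Xq Yr cX cY); have := norm1_ge0 (fun x => q x - r x).
move: (norm1 _) => t t0; field; rewrite !gt_eqF//; lra.
Qed.
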